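(* Let $\mathcal{D}$ be an arbitrary distribution on polygonal curves of complexity $m$ whose vertices lie in the unit Euclidean ball $B_2^d\subseteq\mathbb{R}^d$. Let $P=\{\sigma_1,\dots,\sigma_n\}$ be an i.i.d. sample from $\mathcal{D}$ of size $n$. Then the Rademacher and Gaussian complexities for learning the median curve of complexity $m$ satisfy $$\mathcal{R}(P),\mathcal{G}(P)\in O\!\left(\sqrt{\frac{m^3\cdot\min\{d\log m,\ m^2\log^4(mn)\}}{n}}\right)$$ when $d(\cdot,\cdot)$ is the DTW distance, and $$\mathcal{R}(P),\mathcal{G}(P)\in O\!\left(\sqrt{\frac{m k^2\cdot\min\{d\log k,\ k^2\log^4(mn)\}}{n}}\right)$$ when $d(\cdot,\cdot)$ is the $k$-DTW distance.
   Context: Curves are vertex sequences. For $\sigma=(v_1,\dots,v_{m'})$, $\tau=(w_1,\dots,w_{m''})$, a traversal $T$ is a sequence of index pairs starting with $(1,1)$, ending with $(m',m'')$, each $(i,j)$ followed only by $(i+1,j)$, $(i,j+1)$ or $(i+1,j+1)$. DTW: $d_{DTW}(\sigma,\tau)=\min_T\sum_{(i,j)\in T}\|v_i-w_j\|$. $k$-DTW: with $s^{(T)}_1\ge s^{(T)}_2\ge\dots$ the matched Euclidean distances of $T$ sorted non-increasingly (zeros beyond $|T|$), $d_{k\text{-}DTW}(\sigma,\tau)=\min_T\sum_{l=1}^k s^{(T)}_l$. Candidate median curves $\psi$ range over curves of complexity $m$ with vertices in $B_2^d$. With $r_1,\dots,r_n$ independent Rademacher ($\pm1$) variables and $g_1,\dots,g_n$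 independent standard Gaussians, $\mathcal{R}(P)=\mathbb{E}\sup_\psi\left|\frac1n\sum_{i=1}^n d(\sigma_i,\psi)r_i\right|$ and $\mathcal{G}(P)=\mathbb{E}\sup_\psi\left|\frac1n\sum_{i=1}^n d(\sigma_i,\psi)g_i\right|$. The $O(\cdot)$ hides absolute constants.
   Formalization: The bounds are stated for m ≥ 2 and, for k-DTW, k ≥ 2: for m = 1 (DTW) or k = 1 (k-DTW) the factor log m or log k is 0, so the claimed bound is 0 while the complexities are positive. *)

(* Defs.v *)
From HB Require Import structures.
From mathcomp Require Import all_boot all_order all_algebra.
From mathcomp Require Import all_classical all_reals all_analysis.
Set Implicit Arguments. Unset Strict Implicit. Unset Printing Implicit Defensive.
Import Order.TTheory GRing.Theory Num.Theory.
Local Open Scope ring_scope.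
Local Open Scope classical_set_scope.

Section Defs.
Variable R : realType.

Definition enorm (d : nat) (v : 'rV[R]_d) : R := Num.sqrt (\sum_(i < d) v ord0 i ^+ 2).

(* A curve is its sequence of vertices; indices are 0-based here.
   A traversal of curves with p and q vertices is (0,0) :: s where each step
   goes (i,j) -> (i+1,j), (i,j+1) or (i+1,j+1), ending at (p-1,q-1). *)
Definition trav_step (a b : nat * nat) : bool :=
  [|| (b.1 == a.1.+1) && (b.2 == a.2),
      (b.1 == a.1) && (b.2 == a.2.+1) |
      (b.1 == a.1.+1) && (b.2 == a.2.+1)].

Definition is_traversal (p q : nat) (s : seq (nat * nat)) : bool :=
  path trav_step (0, 0)%N s && (last (0, 0)%N s == (p.-1, q.-1)).

Definition matched_dists (d : nat) (sigma tau : seq 'rV[R]_d) (s : seq (nat * nat)) : seq R :=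
  [seq enorm (nth 0 sigma ij.1 - nth 0 tau ij.2) | ij <- (0, 0)%N :: s].

Definition dtw (d : nat) (sigma tau : seq 'rV[R]_d) : R :=
  inf [set \sum_(x <- matched_dists sigma tau s) x
      | s in [set s | is_traversal (size sigma) (size tau) s]].

Definition topk_sum (k : nat) (xs : seq R) : R :=
  \sum_(l < k) nth 0 (sort (fun x y => y <= x) xs) l.

Definition kdtw (k d : nat) (sigma tau : seq 'rV[R]_d) : R :=
  inf [set topk_sum k (matched_dists sigma tau s)
      | s in [set s | is_traversal (size sigma) (size tau) s]].

(* candidate median curves: complexity m, vertices in the unit ball *)
Definition unit_ball_curves (d m : nat) : set (m.-tuple 'rV[R]_d) :=
  [set psi | forall j : 'I_m, enorm (tnth psi j) <= 1].

Definition sup_emp (dist : forall d : nat, seq 'rV[R]_d -> seq 'rV[R]_d -> R)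
  (d m n : nat) (P : 'I_n -> m.-tuple 'rV[R]_d) (w : 'I_n -> R) : \bar R :=
  ereal_sup [set (`| n%:R^-1 * \sum_(i < n) @dist d (P i) psi * w i |)%:E
            | psi in @unit_ball_curves d m].

Definition rademacher (dist : forall d : nat, seq 'rV[R]_d -> seq 'rV[R]_d -> R)
  (d m n : nat) (P : 'I_n -> m.-tuple 'rV[R]_d) : \bar R :=
  (((2 ^ n)%:R : R)^-1)%:E *
  (\sum_(r : {ffun 'I_n -> bool})
      sup_emp dist P (fun i => if r i then 1%R else (-1)%R))%E.

(* Expectation of F(g_0,...,g_{n-1}) for i.i.d. standard Gaussians g_i,
   as an iterated integral against the standard normal law. *)
Fixpoint gauss_expect (n : nat) (F : (nat -> R) -> \bar R) : \bar R :=
  match n with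
  | 0 => F (fun _ => 0)
  | n'.+1 => (\int[normal_prob 0 1]_x
                gauss_expect n' (fun g => F (fun i => if i == n' then x else g i)))%E
  end.

Definition gaussian (dist : forall d : nat, seq 'rV[R]_d -> seq 'rV[R]_d -> R)
  (d m n : nat) (P : 'I_n -> m.-tuple 'rV[R]_d) : \bar R :=
  gauss_expect n (fun g => sup_emp dist P (fun i => g (val i))).

End Defs.

(* Main.v *)
Require Import Defs.
From HB Require Import structures.
From mathcomp Require Import all_boot all_order all_algebra.
From mathcomp Require Import all_classical all_reals all_analysis.
From mathcomp Require Import measurable_realfun ring lra zify.
Set Implicit Arguments. Unset Strict Implicit. Unset Printing Implicit Defensive.
Import Order.TTheory GRing.Theory Num.Theory.
Local Open Scope ring_scope.

(* For fixed samples the complexity is the expected supremum of a random process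
   indexed by the candidate curves. The maximum of a finite family of weighted
   sums lies below a sum of exponentials of linear forms in the weights; these
   have explicit expectations under both laws, and the bound is pointwise, so no
   measurability of the supremum is needed. Chaining along finite partitions of
   the set of curves, finer by a factor 4 at each level, turns this into an
   entropy bound.
   Both distances are Lipschitz, with constant [2 m] (DTW) or [k] (k-DTW), in the
   largest change of a vertex distance [|p - x|], so it is enough to partition
   the unit ball. In dimension [d] a grid gives entropy [O(d / e)] at scale [e].
   Independently of [d], a greedy (perceptron) approximation of inner products,
   taken relative to the sample vertex nearest to [x], gives entropy
   [O(log (m n) / e^2)] for the distances from [x] to the [m n] sample vertices. *)

(** * Exponential moments of Gaussian weights *)

Section GaussianIntegral.
Variable R : realType.
Import HBNNSimple.

(** Passing to the Lebesgue density on simple functions is enough: the integral of any nonnegative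
    function is a supremum of such integrals. *)
Lemma normal_prob_sintegral (h : {nnsfun measurableTypeR R >-> R}) :
  sintegral (normal_prob 0 1) h =
  (\int[lebesgue_measure]_x (h x * normal_pdf 0 1 x)%:E)%E.
Proof.
rewrite sintegralE.
under [RHS]eq_integral => x _.
  rewrite EFinM fimfunE -fsumEFin// ge0_mule_fsuml; last first.
    by move=> r; rewrite EFinM nnfun_muleindic_ge0.
  over.
have mpdf : measurable_fun setT (fun x : R => (normal_pdf 0 1 x)%:E).
  by apply/measurable_EFinP; exact: measurable_normal_pdf.
have pdf0 x : (0 <= (normal_pdf 0 1 x : R)%:E)%E by rewrite lee_fin normal_pdf_ge0.
rewrite [RHS]ge0_integral_fsum//; last 2 first.
- move=> r; apply: emeasurable_funM => //; apply/measurable_EFinP.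
  by do 2 apply/measurableT_comp => //.
- by move=> r x _; apply: mule_ge0 => //; rewrite EFinM nnfun_muleindic_ge0.
apply: eq_fsbigr => r; rewrite inE => -[t _ <-].
under eq_integral do rewrite EFinM -muleA.
rewrite ge0_integralZl//; last 3 first.
- apply: emeasurable_funM => //; apply/measurable_EFinP.
  exact: measurable_indic.
- by move=> x _; apply: mule_ge0 => //; rewrite lee_fin.
- by rewrite lee_fin.
congr (_ * _)%E; rewrite /= /normal_prob [LHS]integral_mkcond epatch_indic.
by apply: eq_integral => x _ /=; rewrite muleC.
Qed.

(* The integral of a nonnegative function is a supremum over the simple functions
   below it, hence monotone even when [f] is not measurable. *)
Lemma normal_prob_integral_le (f : R -> \bar R) (g : R -> R) :
  (forall x, 0 <= f x <= (g x)%:E)%E -> measurable_fun setT g ->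
  (\int[normal_prob 0 1]_x f x <=
   \int[lebesgue_measure]_x (g x * normal_pdf 0 1 x)%:E)%E.
Proof.
move=> fg mg; rewrite ge0_integralTE; last by move=> x; case/andP: (fg x).
apply: ge_ereal_sup => _ [h hf <-]; rewrite normal_prob_sintegral.
apply: ge0_le_integral => //.
- by move=> x _; rewrite lee_fin mulr_ge0// normal_pdf_ge0.
- by apply/measurable_EFinP; apply: measurable_funM => //; exact: measurable_normal_pdf.
- by apply/measurable_EFinP; apply: measurable_funM => //; exact: measurable_normal_pdf.
- move=> x _; rewrite lee_fin ler_wpM2r ?normal_pdf_ge0//.
  by rewrite -lee_fin (le_trans (hf x))//; case/andP: (fg x).
Qed.

(** Completing the square turns the integrand into [expR (a ^+ 2 / 2)] times the normal density
    centred at [a]. *)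
Lemma integral_expR_normal_pdf (a : R) :
  (\int[lebesgue_measure]_x (expR (a * x) * normal_pdf 0 1 x)%:E =
   (expR (a ^+ 2 / 2))%:E)%E.
Proof.
have E x : expR (a * x) * normal_pdf 0 1 x = expR (a ^+ 2 / 2) * normal_pdf a 1 x.
  rewrite !normal_pdfE ?oner_neq0// /normal_fun ![_ * (normal_peak _ * _)]mulrCA.
  congr (_ * _); rewrite -!expRD; congr expR; rewrite expr1n mulr2n; by field.
under eq_integral do rewrite E EFinM.
rewrite ge0_integralZl//=; last 2 first.
- by apply/measurable_EFinP; exact: measurable_normal_pdf.
- by move=> x _; rewrite lee_fin normal_pdf_ge0.
by rewrite integral_normal_pdf ?oner_neq0// mule1.
Qed.

Lemma gauss_expect_ge0 n (F : (nat -> R) -> \bar R) :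
  (forall w, 0 <= F w)%E -> (0 <= gauss_expect n F)%E.
Proof.
elim: n F => [|n IH] F F0 /=; first exact: F0.
by apply: integral_ge0 => x _; apply: IH.
Qed.

(** Fixing the last weight at [t] only multiplies each coefficient by [expR (x.2 n * t)], so the
    dominating sum keeps its form through the iterated integral. Only the dominating sum has to be
    measurable. *)
Lemma gauss_expect_le_expsum n (F : (nat -> R) -> \bar R) (s : seq (R * (nat -> R))) :
  (forall x, x \in s -> 0 <= x.1) ->
  (forall w, 0 <= F w <= (\sum_(x <- s) x.1 * expR (\sum_(i < n) x.2 i * w i))%:E)%E ->
  (gauss_expect n F <= (\sum_(x <- s) x.1 * expR (\sum_(i < n) x.2 i ^+ 2 / 2))%:E)%E.
Proof.
elim: n F s => [|n IH] F s s0 Fs /=.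
  case/andP: (Fs (fun=> 0)) => _ /le_trans; apply.
  by rewrite lee_fin; apply: ler_sum => x _; rewrite !big_ord0.
pose u (x : R * (nat -> R)) := x.1 * expR (\sum_(i < n) x.2 i ^+ 2 / 2).
have u0 x : x \in s -> 0 <= u x by move=> /s0 ?; rewrite mulr_ge0 ?expR_ge0.
pose g t := \sum_(x <- s) u x * expR (x.2 n * t).
have mt (x : R * (nat -> R)) : measurable_fun setT (fun t => expR (x.2 n * t)).
  by apply: measurableT_comp => //; exact: measurable_funM.
apply: (@le_trans _ _ (\int[lebesgue_measure]_t (g t * normal_pdf 0 1 t)%:E)%E).
  apply: normal_prob_integral_le => [t|]; last first.
    by apply: measurable_sum => x; apply: measurable_funM.
  rewrite gauss_expect_ge0 /=; last by move=> w; case/andP: (Fs (fun i => if i == n then t else w i)).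
  pose s' := [seq (x.1 * expR (x.2 n * t), x.2) | x <- s].
  apply: (le_trans (IH _ s' _ _)).
  - by move=> _ /mapP[x xs ->] /=; rewrite mulr_ge0 ?s0 ?expR_ge0.
  - move=> w; case/andP: (Fs (fun i => if i == n then t else w i)) => -> /= H.
    apply: (le_trans H); rewrite lee_fin big_map /=; apply: ler_sum => x _.
    rewrite big_ord_recr/= eqxx expRD mulrA mulrAC.
    by under eq_bigr => i _ do rewrite (ltn_eqF (ltn_ord i)).
  - rewrite lee_fin big_map /g; apply: ler_sum => x _ /=.
    by rewrite mulrAC.
(* Exchanging sum and integral asks for nonnegative terms at every index, so coefficients outside
   [s] are set to 0. *)
rewrite [leLHS](_ : _ = \int[lebesgue_measure]_t
   (\sum_(x <- s) ((if x \in s then u x else 0) * (expR (x.2 n * t) * normal_pdf 0 1 t))%:E))%E; last first.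
  apply: eq_integral => t _; rewrite sumEFin mulr_suml big_seq [in RHS]big_seq.
  by congr EFin; apply: eq_bigr => x ->; rewrite mulrA.
rewrite ge0_integral_sum//; last 2 first.
- move=> x; apply/measurable_EFinP; apply: measurable_funM => //.
  by apply: measurable_funM; [exact: mt|exact: measurable_normal_pdf].
- move=> x t _; rewrite lee_fin mulr_ge0//; first by case: ifP => // /u0.
  by rewrite mulr_ge0 ?expR_ge0 ?normal_pdf_ge0.
rewrite -sumEFin big_seq [leRHS]big_seq; apply: lee_sum => x xs; rewrite xs.
under eq_integral do rewrite EFinM.
rewrite ge0_integralZl//; last 3 first.
- apply/measurable_EFinP.
  by apply: measurable_funM; [exact: mt|exact: measurable_normal_pdf].
- by move=> t _; rewrite lee_fin mulr_ge0 ?expR_ge0 ?normal_pdf_ge0.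
- by rewrite lee_fin u0.
by rewrite integral_expR_normal_pdf -EFinM lee_fin big_ord_recr/= expRD mulrA.
Qed.

End GaussianIntegral.

(** * Domination by exponentials of linear forms *)

Section ExponentialDomination.
Variable R : realType.

(** For [a >= 1/2], both exponents are at most [2 * a ^+ 2]. For [0 <= a < 1/2],
    [expR (- a) <= 1 / (1 + a)] and its mirror image add up to
    [2 / (1 - a ^+ 2) <= 2 * (1 + 2 * a ^+ 2)]. *)
Lemma cosh_le (a : R) : expR a + expR (- a) <= 2 * expR (2 * a ^+ 2).
Proof.
wlog a0 : a / 0 <= a => [H|].
  have [/H//|a0] := leP 0 a; have := H (- a).
  by rewrite opprK sqrrN addrC; apply; rewrite oppr_ge0 ltW.
have [a2|a2] := leP (1 / 2) a.
  have aa : a <= 2 * a ^+ 2 by rewrite expr2; nra.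
  have : expR a <= expR (2 * a ^+ 2) by rewrite ler_expR.
  have : expR (- a) <= expR (2 * a ^+ 2) by rewrite ler_expR; nra.
  lra.
have h1 : expR (- a) <= (1 + a)^-1.
  by rewrite expRN lef_pV2 ?posrE ?expR_gt0 ?expR_ge1Dx//; lra.
have h2 : expR a <= (1 - a)^-1.
  rewrite -[a in leLHS]opprK expRN lef_pV2 ?posrE ?expR_gt0 ?expR_ge1Dx//; lra.
apply: (le_trans (lerD h2 h1)).
rewrite (_ : _ + _ = 2 * (1 - a ^+ 2)^-1); last by field; apply/and3P; split; apply: lt0r_neq0; nra.
rewrite ler_pM2l// (le_trans _ (expR_ge1Dx _))// -div1r ler_pdivrMr; last by nra.
have : 0 <= a ^+ 2 <= 1 / 2 by rewrite sqr_ge0; nra.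
by move: (a ^+ 2) => t /andP[]; nra.
Qed.

(* [expR (2 * |a|^2)] bounds the expectation of [expR <a, w>] for Rademacher as
   well as for standard Gaussian weights [w]. *)
Definition exp_dominated n (G : ('I_n -> R) -> R) (B : R) :=
  exists s : seq (R * ('I_n -> R)), [/\ forall x, x \in s -> 0 <= x.1,
    forall w, G w <= \sum_(x <- s) x.1 * expR (\sum_i x.2 i * w i) &
    \sum_(x <- s) x.1 * expR (2 * \sum_i x.2 i ^+ 2) <= B].

Lemma exp_dominatedW n (G G' : ('I_n -> R) -> R) B B' :
  (forall w, G' w <= G w) -> B <= B' -> exp_dominated G B -> exp_dominated G' B'.
Proof.
move=> GG BB [s [s0 sG sB]]; exists s; split=> //; last exact: le_trans BB.
by move=> w; exact: le_trans (sG w).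
Qed.

Lemma exp_dominated0 n : @exp_dominated n (fun=> 0) 0.
Proof. by exists [::]; split=> // [w|]; rewrite big_nil. Qed.

Lemma exp_dominatedD n (G1 G2 : ('I_n -> R) -> R) B1 B2 :
  exp_dominated G1 B1 -> exp_dominated G2 B2 ->
  exp_dominated (fun w => G1 w + G2 w) (B1 + B2).
Proof.
move=> [s1 [s10 sG1 sB1]] [s2 [s20 sG2 sB2]]; exists (s1 ++ s2); split.
- by move=> x; rewrite mem_cat => /orP[/s10|/s20].
- by move=> w; rewrite big_cat lerD.
- by rewrite big_cat lerD.
Qed.

Lemma exp_dominated_sum n I (r : seq I) (G : I -> ('I_n -> R) -> R) B :
  (forall i, exp_dominated (G i) (B i)) ->
  exp_dominated (fun w => \sum_(i <- r) G i w) (\sum_(i <- r) B i).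
Proof.
move=> GB; elim: r => [|i r IH].
  apply: exp_dominatedW (@exp_dominated0 n) => [w|]; by rewrite big_nil.
apply: exp_dominatedW (exp_dominatedD (GB i) IH) => [w|]; by rewrite big_cons.
Qed.

Lemma exp_dominatedZ n (G : ('I_n -> R) -> R) B c : 0 <= c ->
  exp_dominated G B -> exp_dominated (fun w => c * G w) (c * B).
Proof.
move=> c0 [s [s0 sG sB]]; exists [seq (c * x.1, x.2) | x <- s]; split.
- by move=> _ /mapP[x /s0 x0 ->]; rewrite mulr_ge0.
- move=> w; rewrite big_map/=; under eq_bigr do rewrite -mulrA.
  by rewrite -mulr_sumr ler_wpM2l.
- rewrite big_map/=; under eq_bigr do rewrite -mulrA.
  by rewrite -mulr_sumr ler_wpM2l.
Qed.

Lemma exp_dominated_exp n (a : 'I_n -> R) :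
  exp_dominated (fun w => expR (\sum_i a i * w i)) (expR (2 * \sum_i a i ^+ 2)).
Proof.
exists [:: (1, a)]; split=> [x|w|]; rewrite ?big_seq1 ?mul1r//.
by rewrite inE => /eqP->.
Qed.

Lemma exp_dominated_cst n c : 0 <= c -> @exp_dominated n (fun=> c) c.
Proof.
move=> c0; apply: exp_dominatedW (exp_dominatedZ c0 (@exp_dominated_exp n (fun=> 0))) => [w|].
  by rewrite big1 ?expR0 ?mulr1// => i _; rewrite mul0r.
by rewrite big1 ?mulr0 ?expR0 ?mulr1// => i _; rewrite expr0n.
Qed.

(** Uses [|y| <= expR y + expR (- y)]. It pays for the remainder that chaining leaves at the last
    level. *)
Lemma exp_dominated_norm n (i : 'I_n) :
  exp_dominated (fun w => `|w i|) (2 * expR 2).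
Proof.
pose a (c : R) j := if j == i then c else 0.
have S c (w : 'I_n -> R) : \sum_j a c j * w j = c * w i.
  rewrite (bigD1 i)//= /a eqxx big1 ?addr0// => j /negbTE->.
  by rewrite mul0r.
have S2 c : c ^+ 2 = 1 -> \sum_j a c j ^+ 2 = 1.
  move=> c1; rewrite (bigD1 i)//= /a eqxx c1 big1 ?addr0// => j /negbTE->.
  by rewrite expr0n.
apply: exp_dominatedW (exp_dominatedD (exp_dominated_exp (a 1)) (exp_dominated_exp (a (-1)))).
  move=> w; rewrite !S mul1r mulN1r.
  have := expR_ge1Dx (w i); have := expR_ge1Dx (- w i).
  have := expR_gt0 (w i); have := expR_gt0 (- w i).
  by case: (ger0P (w i)); lra.
by rewrite !S2 ?expr1n ?sqrrN ?expr1n// mulr1; lra.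
Qed.

(* Since [y <= exp (l (y - A)) / l + A] for [y = |<V k, w>|], the maximum is
   below a sum over [k]; [A] and [l] balance the number of terms against [v]. *)
Lemma exp_dominated_max n (K : finType) (V : K -> 'I_n -> R) (v H : R) :
  0 < v -> 1 <= H -> #|K|%:R <= expR H -> (forall k, \sum_i V k i ^+ 2 <= v) ->
  exists2 G, exp_dominated G (2 * Num.sqrt (8 * v * H)) &
    forall w k, `|\sum_i V k i * w i| <= G w.
Proof.
move=> v0 H1 KH Vv; set A := Num.sqrt _.
have A0 : 0 < A by rewrite sqrtr_gt0 !mulr_gt0//; lra.
have A2 : A ^+ 2 = 8 * v * H by rewrite sqr_sqrtr// !mulr_ge0//; lra.
(* With this [l], [l * A = 2 * H] and [l ^+ 2 * v = H / 2], so each exponential costs at most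
   [expR (- H) / l]. The [2 * #|K|] of them cost at most [2 / l], which is at most [A] because
   [H >= 1]. *)
pose l := A / (4 * v).
have l0 : 0 < l by rewrite divr_gt0// mulr_gt0.
have e1 : l * A = 2 * H by rewrite /l mulrAC -expr2 A2; field; rewrite gt_eqF.
have e2 : l ^+ 2 * v = H / 2 by rewrite /l expr_div_n A2; field; rewrite gt_eqF.
have lA : l^-1 * 2 <= A.
  rewrite /l invf_div mulrC mulrA ler_pdivrMr// -expr2 A2.
  rewrite (_ : 2 * (4 * v) = 8 * v * 1) ?ler_pM2l//; last by ring.
  by rewrite mulr_gt0.
clearbody l.
pose g (c : R) k w := l^-1 * expR (- (l * A)) * expR (\sum_i (c * l * V k i) * w i).
pose G w := A + \sum_(k : K) (g 1 k w + g (-1) k w).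
have gB c k : c ^+ 2 = 1 -> exp_dominated (g c k) (l^-1 * expR (- H)).
  move=> c1.
  have c0 : 0 <= l^-1 * expR (- (l * A)) by rewrite mulr_ge0 ?expR_ge0 ?invr_ge0 ?ltW.
  apply: exp_dominatedW (exp_dominatedZ c0 (exp_dominated_exp _)) => // [w|]; first exact: lexx.
  rewrite -mulrA ler_pM2l ?invr_gt0// -expRD ler_expR.
  under eq_bigr do rewrite !exprMn c1 mul1r.
  rewrite -mulr_sumr.
  have : l ^+ 2 * (\sum_i V k i ^+ 2) <= l ^+ 2 * v by rewrite ler_wpM2l ?sqr_ge0.
  by rewrite e1; lra.
exists G.
  apply: exp_dominatedW (exp_dominatedD (exp_dominated_cst n (ltW A0))
    (exp_dominated_sum (index_enum K) (fun k =>
       exp_dominatedD (gB 1 k (expr1n _ _)) (gB (-1) k _)))) => //; last first.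
    by rewrite sqrrN expr1n.
  rewrite sumr_const mulrDl mul1r lerD2l -mulr_natr.
  apply: le_trans lA.
  have KH' : expR (- H) * #|K|%:R <= 1.
    by rewrite expRN mulrC ler_pdivrMr ?expR_gt0// mul1r.
  have E (a b c : R) : (a * b + a * b) * c = a * 2 * (b * c) by ring.
  by rewrite E ler_piMr// mulr_ge0// invr_ge0 ltW.
move=> w k.
have g0 c k' : 0 <= g c k' w by rewrite !mulr_ge0 ?expR_ge0 ?invr_ge0 ?ltW.
apply: (@le_trans _ _ (A + (g 1 k w + g (-1) k w))); last first.
  rewrite /G lerD2l (bigD1 k)//= lerDl sumr_ge0// => k' _.
  by rewrite addr_ge0.
set y := \sum_i V k i * w i.
have gE c : g c k w = l^-1 * expR (l * (c * y - A)).
  rewrite /g -mulrA -expRD; congr (_ * expR _).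
  rewrite mulrBr addrC; congr (_ - _); rewrite /y !mulr_sumr.
  by apply: eq_bigr => i _; ring.
rewrite -lerBlDl.
have key z : z - A <= l^-1 * expR (l * (z - A)).
  by rewrite ler_pdivlMl// (le_trans _ (expR_ge1Dx _))// lerDr.
have := key (1 * y); have := key (-1 * y); rewrite -!gE.
have := g0 1 k; have := g0 (-1) k.
by case: (ger0P y); lra.
Qed.

(** The sum over all sign vectors of an exponential of a linear form factorises over the
    coordinates, and [cosh_le] bounds each factor. *)
Lemma rademacher_average_le n (F : ('I_n -> R) -> \bar R) (G : ('I_n -> R) -> R) B :
  exp_dominated G B -> (forall w, F w <= (G w)%:E)%E ->
  ((((2 ^ n)%:R : R)^-1)%:E *
    (\sum_(r : {ffun 'I_n -> bool}) F (fun i => if r i then 1%R else (-1)%R)) <= B%:E)%E.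
Proof.
move=> [s [s0 sG sB]] FG.
rewrite lee_pdivrMl ?ltr0n ?expn_gt0// -EFinM.
apply: (@le_trans _ _ (\sum_(r : {ffun 'I_n -> bool}) \sum_(x <- s) x.1 *
    expR (\sum_i x.2 i * (if r i then 1%R else (-1)%R)))%:E).
  rewrite -sumEFin; apply: lee_sum => r _; apply: (le_trans (FG _)).
  by rewrite lee_fin.
rewrite lee_fin exchange_big/=.
apply: (@le_trans _ _ ((2 ^ n)%:R * \sum_(x <- s) x.1 * expR (2 * \sum_i x.2 i ^+ 2))); last first.
  by rewrite ler_wpM2l.
rewrite mulr_sumr big_seq [leRHS]big_seq; apply: ler_sum => x xs.
rewrite -mulr_sumr mulrCA ler_wpM2l ?s0//.
under eq_bigr => r _ do rewrite expR_sum.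
rewrite -(bigA_distr_bigA (fun i (b : bool) => expR (x.2 i * (if b then 1 else -1)))).
rewrite mulr_sumr expR_sum natrX -[n in _ ^+ n]card_ord -prodr_const -big_split/=.
apply: ler_prod => i _; rewrite big_bool/= addr_ge0 ?expR_ge0//=.
by rewrite mulr1 mulrN1 cosh_le.
Qed.

Lemma gaussian_average_le n (F : ('I_n -> R) -> \bar R) (G : ('I_n -> R) -> R) B :
  exp_dominated G B -> (forall w, 0 <= F w <= (G w)%:E)%E ->
  (gauss_expect n (fun g => F (fun i => g (val i))) <= B%:E)%E.
Proof.
move=> [s [s0 sG sB]] FG.
(* [gauss_expect] uses weights indexed by [nat], so linear forms are extended by 0 beyond [n]. *)
pose ext (a : 'I_n -> R) k := if insub k is Some j then a j else 0.
have extE a i : ext a (val i) = a i by rewrite /ext valK.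
pose s' := [seq (x.1, ext x.2) | x <- s].
apply: (le_trans (@gauss_expect_le_expsum _ _ _ s' _ _)).
- by move=> _ /mapP[x /s0 x0 ->].
- move=> w; case/andP: (FG (fun i => w (val i))) => -> /= /le_trans; apply.
  rewrite lee_fin (le_trans (sG _))// big_map/=; apply: ler_sum => x _.
  by under [in leRHS]eq_bigr => i _ do rewrite extE.
- rewrite lee_fin (le_trans _ sB)// big_map/= big_seq [leRHS]big_seq.
  apply: ler_sum => x xs; rewrite ler_wpM2l ?s0// ler_expR mulr_sumr.
  apply: ler_sum => i _; rewrite extE; have := sqr_ge0 (x.2 i); lra.
Qed.

End ExponentialDomination.

(** * Chaining *)

Section Chaining.
Variables (R : realType) (n : nat) (T : Type) (X : set T) (f : T -> 'I_n -> R).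
Variables (K : nat -> finType) (code : forall l, T -> K l) (D h b : R).
Hypotheses (n0 : (0 < n)%N) (D0 : 0 < D) (h1 : 1 <= h) (b1 : 1 <= b).
Hypothesis f_le : forall x i, X x -> `|f x i| <= D.
Hypothesis codeP : forall l x y i, X x -> X y -> code l x = code l y ->
  `|f x i - f y i| <= D / 4 ^+ l.
Hypothesis card_code : forall l, #|K l|%:R <= expR ((h * b ^+ l) ^+ 2).

(** The process at a chosen point of the cell [k]; cells that miss [X] get the value 0. *)
Let rep l (k : K l) (i : 'I_n) : R :=
  if pselect (exists x, X x /\ code l x = k) is left e then f (projT1 (cid e)) i else 0.

Let repP l x : X x -> exists y, [/\ X y, code l y = code l x &
  forall i, rep (code l x) i = f y i].
Proof.
move=> Xx; rewrite /rep; case: pselect => [e|[]]; last by exists x.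
by case: (cid e) => y [Xy yx] /=; exists y.
Qed.

Let nR0 : 0 < n%:R :> R. Proof. by rewrite ltr0n. Qed.

(** Not every pair of cells shares a point, so a family of differences may have large members. These
    are replaced by 0, and the others have squared norm at most [n * (c / n) ^+ 2 = c ^+ 2 / n]
    after the scaling by [1 / n]. *)
Let scaled_family (J : finType) (V : J -> 'I_n -> R) (c H : R) :
  0 < c -> 1 <= H -> #|J|%:R <= expR H ->
  exists2 G, exp_dominated G (2 * Num.sqrt (8 * (c ^+ 2 / n%:R) * H)) &
    forall w j, (forall i, `|V j i| <= c) -> `|n%:R^-1 * \sum_i V j i * w i| <= G w.
Proof.
move=> c0 H1 JH.
pose V' j i := n%:R^-1 * (if [forall i', `|V j i'| <= c] then V j i else 0).
have [|j|G GB GV] := @exp_dominated_max R n J V' (c ^+ 2 / n%:R) H _ H1 JH.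
- by rewrite divr_gt0// exprn_gt0.
- apply: (@le_trans _ _ (\sum_(i < n) (n%:R^-1 * c) ^+ 2)).
    apply: ler_sum => i _; rewrite /V' !exprMn ler_pM2l ?exprn_gt0 ?invr_gt0//.
    case: ifP => [/forallP/(_ i)|_]; last by rewrite expr0n sqr_ge0.
    by rewrite -real_normK ?num_real// ler_sqr// nnegrE ltW.
  rewrite sumr_const card_ord -mulr_natl le_eqVlt; apply/orP; left; apply/eqP.
  by field; rewrite gt_eqF.
exists G => // w j Vj; apply: le_trans (GV w j); rewrite mulr_sumr.
rewrite le_eqVlt; apply/orP; left; apply/eqP; congr (`|_|).
apply: eq_bigr => i _; rewrite /V' -mulrA.
by have -> : [forall i', `|V j i'| <= c] by apply/forallP.
Qed.

(** The cost of level [l] is geometric of ratio [b / 4]: summable for [b = 2], constant for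
    [b = 4]. *)
Let link_bound l : 2 * Num.sqrt (8 * ((2 * D / 4 ^+ l) ^+ 2 / n%:R) * (2 * (h * b ^+ l.+1) ^+ 2))
  = 16 * b * D * h / Num.sqrt n%:R * (b / 4) ^+ l.
Proof.
rewrite (_ : _ * _ = (4 * (2 * D / 4 ^+ l * (h * b ^+ l.+1))) ^+ 2 * n%:R^-1); last by ring.
have h0 : 0 <= h := le_trans ler01 h1.
have b0 : 0 <= b := le_trans ler01 b1.
rewrite sqrtrM ?sqr_ge0// sqrtr_sqr sqrtrV ?ler0n// ger0_norm; last first.
  by rewrite !mulr_ge0 ?invr_ge0 ?exprn_ge0// ltW.
by rewrite exprS expr_div_n; ring.
Qed.

(** The process telescopes into its level 0 representative (constant 6), [L] links between
    consecutive levels, and a remainder of size [D / 4 ^+ L] per coordinate (constant [2 * expR 2]).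
    As [4 ^ L >= n], the remainder is within the rate [1 / sqrt n]. *)
Lemma chaining L : (n <= 4 ^ L)%N ->
  exists2 G, exp_dominated G (D * h / Num.sqrt n%:R *
      (16 * b * (\sum_(l < L) (b / 4) ^+ l) + 6 + 2 * expR 2)) &
    forall w x, X x -> `|n%:R^-1 * \sum_i f x i * w i| <= G w.
Proof.
move=> nL.
have h0 : 0 < h := lt_le_trans ltr01 h1.
have b0 : 0 < b := lt_le_trans ltr01 b1.
have [G0 G0B G0V] := @scaled_family (K 0%N) (@rep 0%N) D (h ^+ 2) D0
  (exprn_ege1 2 h1) (le_trans (card_code 0) (ltac:(by rewrite expr0 mulr1))).
have link l : exists G, exp_dominated G (16 * b * D * h / Num.sqrt n%:R * (b / 4) ^+ l) /\
    forall w x, X x ->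
      `|n%:R^-1 * \sum_i (rep (code l.+1 x) i - rep (code l x) i) * w i| <= G w.
  have c0 : 0 < 2 * D / 4 ^+ l by rewrite divr_gt0 ?mulr_gt0 ?exprn_gt0.
  have hb : 1 <= h * b ^+ l.+1 by rewrite mulr_ege1 ?exprn_ege1.
  (* The partitions need not be nested, so links are indexed by pairs of codes, which doubles the
     entropy of level [l.+1]. Both representatives are close to [x], so a link is at most [D / 4 ^+
     l.+1 + D / 4 ^+ l <= 2 * D / 4 ^+ l]. *)
  have [||G GB GV] := @scaled_family (K l.+1 * K l)%type
    (fun p i => rep p.1 i - rep p.2 i) _ (2 * (h * b ^+ l.+1) ^+ 2) c0.
  - have := exprn_ege1 2 hb; lra.
  - rewrite card_prod natrM mulr2n mulrDl mul1r expRD ler_pM//.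
    apply: (le_trans (card_code l)); rewrite ler_expR ler_sqr ?nnegrE; last 2 first.
    - by rewrite mulr_ge0 ?exprn_ge0; lra.
    - by lra.
    by rewrite ler_pM2l// exprS ler_peMl// exprn_ge0; lra.
  exists G; split; first by rewrite -link_bound.
  move=> w x Xx; apply: (GV w (code l.+1 x, code l x)) => i /=.
  have [y [Xy yx ->]] := repP l.+1 Xx.
  have [z [Xz zx ->]] := repP l Xx.
  have := codeP i Xy Xx yx; have := codeP i Xx Xz (esym zx).
  rewrite (_ : f y i - f z i = (f y i - f x i) + (f x i - f z i)); last by ring.
  move=> e1 e2; apply: (le_trans (ler_normD _ _)); apply: (le_trans (lerD e2 e1)).
  have -> : D / 4 ^+ l.+1 = D / 4 ^+ l / 4 by rewrite exprSr invfM mulrA.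
  have : 0 < D / 4 ^+ l by rewrite divr_gt0 ?exprn_gt0.
  by rewrite -mulrA; lra.
have [G GP] := choice link.
pose Gr (w : 'I_n -> R) := D / 4 ^+ L * (n%:R^-1 * \sum_(i < n) `|w i|).
have GrB : exp_dominated Gr (D / 4 ^+ L * (2 * expR 2)).
  rewrite (_ : 2 * expR 2 = n%:R^-1 * \sum_(i < n) (2 * expR 2)); last first.
    by rewrite sumr_const card_ord -(mulr_natl (2 * expR 2)) mulKf ?gt_eqF.
  apply: exp_dominatedZ; first by rewrite divr_ge0 ?exprn_ge0 ?ltW.
  apply: exp_dominatedZ; first by rewrite invr_ge0 ler0n.
  by apply: exp_dominated_sum => i; exact: exp_dominated_norm.
exists (fun w => G0 w + \sum_(l < L) G l w + Gr w).
  apply: exp_dominatedW (exp_dominatedD (exp_dominatedD G0B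
    (exp_dominated_sum (index_enum 'I_L) (fun l => (GP l).1))) GrB) => //.
  rewrite [leRHS]mulrDr [_ * (_ + 6)]mulrDr; apply: lerD; last first.
    apply: ler_wpM2r; first by have := expR_ge0 (2 : R); lra.
    apply: (@le_trans _ _ (D / Num.sqrt n%:R)); last first.
      by rewrite ler_wpM2r ?invr_ge0 ?sqrtr_ge0// ler_peMr// ltW.
    rewrite ler_pM2l// lef_pV2 ?posrE ?exprn_gt0 ?sqrtr_gt0//.
    apply: (@le_trans _ _ n%:R); last by rewrite -natrX ler_nat.
    rewrite -[leRHS]sqr_sqrtr ?ler0n// expr2 ler_peMl ?sqrtr_ge0//.
    by rewrite -[leLHS]sqrtr1 ler_sqrt ?ler1n.
  rewrite addrC; apply: lerD.
    rewrite -mulr_sumr mulrA ler_wpM2r//.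
      by apply: sumr_ge0 => l _; rewrite exprn_ge0//; lra.
    by rewrite le_eqVlt; apply/orP; left; apply/eqP; ring.
  (* Level 0: the constant 6 comes from [sqrt 8 <= 3]. *)
  rewrite (_ : 8 * _ * _ = (D * h) ^+ 2 * (8 / n%:R)); last by ring.
  rewrite sqrtrM ?sqr_ge0// sqrtr_sqr ger0_norm; last by rewrite mulr_ge0 ?ltW.
  rewrite sqrtrM// sqrtrV ?ler0n// mulrCA -!mulrA ler_pM2l// ler_pM2l//.
  rewrite mulrA mulrC ler_pM2l ?invr_gt0 ?sqrtr_gt0//.
  rewrite (_ : 6 = 2 * 3); last by ring.
  rewrite ler_pM2l// (_ : 3 = Num.sqrt (3 ^+ 2)) ?ler_sqrt ?sqrtr_sqr ?ger0_norm//; nra.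
move=> w x Xx.
pose S (v : 'I_n -> R) := n%:R^-1 * \sum_i v i * w i.
have tel l : S (rep (code l x)) = S (rep (code 0%N x)) +
    \sum_(l' < l) S (fun i => rep (code l'.+1 x) i - rep (code l' x) i).
  elim: l => [|l IH]; first by rewrite big_ord0 addr0.
  rewrite big_ord_recr/= addrA -IH -mulrDr -big_split/=; congr (_ * _).
  by apply: eq_bigr => i _; rewrite -mulrDl addrC subrK.
have -> : n%:R^-1 * \sum_i f x i * w i = S (rep (code L x)) + S (fun i => f x i - rep (code L x) i).
  rewrite -mulrDr -big_split/=; congr (_ * _).
  by apply: eq_bigr => i _; rewrite -mulrDl addrC subrK.
rewrite tel; apply: (le_trans (ler_normD _ _)); apply: lerD.
  apply: (le_trans (ler_normD _ _)); apply: lerD.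
    apply: G0V => i; have [y [Xy _ ->]] := repP 0%N Xx; exact: f_le.
  apply: (le_trans (ler_norm_sum _ _ _)); apply: ler_sum => l _.
  exact: (GP l).2.
rewrite /S /Gr normrM ger0_norm ?invr_ge0 ?ler0n// mulrCA ler_pM2l ?invr_gt0//.
rewrite mulr_sumr; apply: (le_trans (ler_norm_sum _ _ _)); apply: ler_sum => i _.
rewrite normrM ler_wpM2r//; have [y [Xy yx ->]] := repP L Xx.
exact: codeP.
Qed.

End Chaining.

(** * Partitions of the unit ball *)

Section Euclidean.
Variables (R : realType) (d : nat).
Implicit Types u v w : 'rV[R]_d.

Definition dot u v : R := \sum_(i < d) u ord0 i * v ord0 i.

Lemma dotC u v : dot u v = dot v u.
Proof. by apply: eq_bigr => i _; rewrite mulrC. Qed.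

Lemma dotDl u v w : dot (u + v) w = dot u w + dot v w.
Proof. by rewrite -big_split; apply: eq_bigr => i _; rewrite mxE mulrDl. Qed.

Lemma dotZl c u v : dot (c *: u) v = c * dot u v.
Proof. by rewrite mulr_sumr; apply: eq_bigr => i _; rewrite mxE mulrA. Qed.

Lemma dotNl u v : dot (- u) v = - dot u v.
Proof. by rewrite -scaleN1r dotZl mulN1r. Qed.

Lemma dot0l u : dot 0 u = 0.
Proof. by rewrite -(scale0r u) dotZl mul0r. Qed.

Lemma dotDr u v w : dot u (v + w) = dot u v + dot u w.
Proof. by rewrite dotC dotDl !(dotC u). Qed.

Lemma dotZr c u v : dot u (c *: v) = c * dot u v.
Proof. by rewrite dotC dotZl dotC. Qed.

Lemma dotNr u v : dot u (- v) = - dot u v.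
Proof. by rewrite dotC dotNl dotC. Qed.

Lemma dot_ge0 u : 0 <= dot u u.
Proof. by apply: sumr_ge0 => i _; rewrite -expr2 sqr_ge0. Qed.

Lemma enormE u : enorm u = Num.sqrt (dot u u).
Proof. by congr Num.sqrt; apply: eq_bigr => i _; rewrite expr2. Qed.

Lemma enorm_ge0 u : 0 <= enorm u. Proof. exact: sqrtr_ge0. Qed.

Lemma sqr_enorm u : enorm u ^+ 2 = dot u u.
Proof. by rewrite enormE sqr_sqrtr ?dot_ge0. Qed.

Lemma sqr_enormB u v : enorm (u - v) ^+ 2 = enorm u ^+ 2 - 2 * dot u v + enorm v ^+ 2.
Proof.
by rewrite !sqr_enorm dotDl !dotDr !dotNl !dotNr (dotC v u); ring.
Qed.

Lemma enorm0 : enorm (0 : 'rV[R]_d) = 0.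
Proof. by rewrite enormE dot0l sqrtr0. Qed.

Lemma enormN u : enorm (- u) = enorm u.
Proof. by rewrite !enormE dotNl dotNr opprK. Qed.

Lemma enormBC u v : enorm (u - v) = enorm (v - u).
Proof. by rewrite -enormN opprB. Qed.

Lemma enormZ c u : enorm (c *: u) = `|c| * enorm u.
Proof. by rewrite !enormE dotZl dotZr mulrA -expr2 sqrtrM ?sqr_ge0// sqrtr_sqr. Qed.

Lemma enorm_eq0 u : enorm u = 0 -> u = 0.
Proof.
move=> u0; have : dot u u = 0 by rewrite -sqr_enorm u0 expr0n.
move=> /eqP; rewrite psumr_eq0 => [/allP uu|i _]; last by rewrite -expr2 sqr_ge0.
apply/rowP => i; rewrite mxE; apply/eqP.
by have := uu i (mem_index_enum _); rewrite mulf_eq0 orbb.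
Qed.

(** Cauchy-Schwarz, from the nonnegative square of the norm of [enorm v *: u - enorm u *: v]. *)
Lemma dot_le u v : dot u v <= enorm u * enorm v.
Proof.
have [->|v0] := eqVneq v 0; first by rewrite enorm0 mulr0 dotC dot0l.
have vp : 0 < enorm v.
  by rewrite lt_def enorm_ge0 andbT; apply: contraNneq v0 => /enorm_eq0 ->.
have [->|u0] := eqVneq u 0; first by rewrite enorm0 mul0r dot0l.
have up : 0 < enorm u.
  by rewrite lt_def enorm_ge0 andbT; apply: contraNneq u0 => /enorm_eq0 ->.
have := sqr_ge0 (enorm (enorm v *: u - enorm u *: v)).
rewrite sqr_enormB !enormZ !ger0_norm ?enorm_ge0// dotZl dotZr.
rewrite (_ : _ + _ = 2 * (enorm u * enorm v) * (enorm u * enorm v - dot u v)); last by ring.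
by rewrite pmulr_rge0 ?subr_ge0// !mulr_gt0.
Qed.

Lemma enormD_le u v : enorm (u + v) <= enorm u + enorm v.
Proof.
rewrite -ler_sqr ?nnegrE ?addr_ge0 ?enorm_ge0// sqr_enorm dotDl !dotDr.
by rewrite sqrrD !sqr_enorm (dotC v u); have := dot_le u v; lra.
Qed.

Lemma enormB_le u v w : enorm (u - w) <= enorm (u - v) + enorm (v - w).
Proof. by rewrite -[u - w](subrKA v) enormD_le. Qed.

Lemma enormB_norm_le u v w : `|enorm (u - v) - enorm (u - w)| <= enorm (v - w).
Proof.
have := enormB_le u v w; have := enormB_le u w v; rewrite (enormBC w v).
by case: ger0P; lra.
Qed.

End Euclidean.

(** * Finite codes and a grid on the unit ball *)

Section Codes.
Variable R : realType.

(** A partition into at most [N] cells, given by labels; labels of the vertices of a curve combine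
    into a label of the curve. *)
Definition coded (T : Type) (X : set T) (E : T -> T -> Prop) (N : nat) :=
  exists (K : finType) (c : T -> K),
    (#|K| <= N)%N /\ forall x y, X x -> X y -> c x = c y -> E x y.

Lemma coded_tuple (T : Type) (X : set T) E N m : coded X E N ->
  coded (fun t : m.-tuple T => forall j, X (tnth t j))
    (fun s t => forall j, E (tnth s j) (tnth t j)) (N ^ m).
Proof.
move=> [K [c [KN cE]]]; exists (m.-tuple K), (map_tuple c); split.
  by rewrite card_tuple; case: m => // m; rewrite leq_exp2r.
move=> s t Xs Xt st j; apply: cE => //.
by have := congr1 (fun u : m.-tuple K => tnth u j) st; rewrite !tnth_map.
Qed.

Lemma bin_le_exp2 n k : ('C(n, k) <= 2 ^ n)%N.
Proof.
elim: n k => [|n IH] [|k]; rewrite ?bin0 ?expn_gt0// binS expnS mul2n -addnn.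
by rewrite leq_add.
Qed.

(** Coordinates are rounded at mesh [1 / s] with [s = sqrt d * e]. By Cauchy-Schwarz the rounded
    moduli sum to at most [N = d * e], and a binomial coefficient, at most [2 ^ (d + N)], counts
    such tuples; signs contribute [2 ^ d]. Counting by the sum makes the exponent linear in [d * e],
    free of [log d]. *)
Lemma unit_ball_grid_code d e : (0 < e)%N ->
  coded (fun x : 'rV[R]_d => enorm x <= 1)
    (fun x y => enorm (x - y) <= e%:R^-1) (2 ^ (4 * (d * e)))%N.
Proof.
move=> e0.
have [->|d0] := posnP d.
  exists unit, (fun=> tt); split; first by rewrite card_unit expn_gt0.
  by move=> x y _ _ _; rewrite /enorm big_ord0 sqrtr0 invr_ge0 ler0n.
pose N := (d * e)%N; pose s : R := Num.sqrt d%:R * e%:R.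
have sd0 : 0 < Num.sqrt (d%:R : R) by rewrite sqrtr_gt0 ltr0n.
have s0 : 0 < s by rewrite mulr_gt0 ?ltr0n.
pose A := [set t : d.-tuple 'I_N.+1 | (\sum_(i <- t) i <= N)%N]%SET.
pose z (x : 'rV[R]_d) i := Num.truncn (`|x ord0 i| * s).
have zP x i : (z x i)%:R <= `|x ord0 i| * s < (z x i).+1%:R.
  by apply: truncn_itv; rewrite mulr_ge0// ltW.
have zN x : enorm x <= 1 -> (\sum_i z x i <= N)%N.
  move=> x1; rewrite -(ler_nat R) natr_sum.
  apply: (@le_trans _ _ (\sum_i `|x ord0 i| * s)).
    by apply: ler_sum => i _; case/andP: (zP x i).
  rewrite -mulr_suml.
  pose a : 'rV[R]_d := \row_i `|x ord0 i|; pose o : 'rV[R]_d := const_mx 1.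
  have oE : enorm o = Num.sqrt d%:R.
    rewrite /enorm; under eq_bigr do rewrite mxE expr1n.
    by rewrite sumr_const card_ord.
  have aE : enorm a = enorm x.
    by congr Num.sqrt; apply: eq_bigr => i _; rewrite mxE real_normK ?num_real.
  have := dot_le a o; rewrite oE aE /dot.
  under eq_bigr do rewrite !mxE mulr1.
  move=> H; apply: (@le_trans _ _ (Num.sqrt d%:R * s)).
    rewrite ler_pM2r//; apply: (le_trans H).
    by rewrite ler_piMl// ltW.
  by rewrite /s mulrA -expr2 sqr_sqrtr ?ler0n// -natrM.
pose c x : d.-tuple 'I_N.+1 := mktuple (fun i => inord (z x i)).
have zlt x i : enorm x <= 1 -> (z x i < N.+1)%N.
  by move=> x1; rewrite ltnS (leq_trans _ (zN _ x1))// (bigD1 i)//= leq_addr.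
have inA x : enorm x <= 1 -> c x \in A.
  move=> x1; rewrite inE big_tuple (leq_trans _ (zN _ x1))//; apply: leq_sum => i _.
  by rewrite tnth_mktuple inordK// zlt.
(* The code is defined on the whole space: tuples outside [A] are sent to [None], one extra
   label. *)
have insE x : enorm x <= 1 -> omap val (insub (c x) : option {t | t \in A}) = Some (c x).
  by move=> x1; case: insubP => [u _ /= ->//|]; rewrite inA.
exists ({ffun 'I_d -> bool} * option {t | t \in A})%type.
exists (fun x : 'rV[R]_d => ([ffun i => 0 <= x ord0 i], insub (c x))).
split.
  rewrite card_prod card_option card_ffun card_bool card_ord card_sig.
  rewrite (eq_card (B := mem A)) ?card_partial_ord_partitions; last by move=> t; rewrite !inE.
  have dN : (d <= N)%N by rewrite leq_pmulr.
  apply: (@leq_trans (2 ^ d * 2 ^ (d + N).+1)%N).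
    rewrite leq_pmul2l ?expn_gt0// expnS mul2n -addnn -addn1 leq_add ?bin_le_exp2//.
    by rewrite expn_gt0.
  by rewrite -expnD leq_exp2l// -/N; move: d0 dN; lia.
move=> x y x1 y1 [] /ffunP xys.
move=> /(congr1 (omap val)); rewrite !insE// => /(congr1 (odflt (c x)))/= xyz.
have zz i : z x i = z y i.
  have := congr1 (fun t : d.-tuple 'I_N.+1 => val (tnth t i)) xyz.
  by rewrite /= !tnth_mktuple !inordK ?zlt.
(* Equal signs turn closeness of the moduli into closeness of the coordinates. *)
have dist i : `|x ord0 i - y ord0 i| <= s^-1.
  rewrite -div1r ler_pdivlMr//.
  have := xys i; rewrite !ffunE; have /andP[] := zP x i; have /andP[] := zP y i.
  rewrite zz -!natr1; set k := (z y i)%:R; move: (x ord0 i) (y ord0 i) => a b.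
  case: (ger0P a) => a0; case: (ger0P b) => b0 h1 h2 h3 h4 // _;
  by case: (ger0P (a - b)) => _; nra.
rewrite -[leRHS]ger0_norm ?invr_ge0 ?ler0n// -sqrtr_sqr ler_sqrt ?sqr_ge0//.
apply: (@le_trans _ _ (\sum_(i < d) s^-1 ^+ 2)).
  apply: ler_sum => i _; rewrite !mxE -real_normK ?num_real// ler_sqr ?nnegrE//.
  by rewrite invr_ge0 ltW.
rewrite sumr_const card_ord /s invfM exprMn -mulrnAl exprVn sqr_sqrtr ?ler0n//.
by rewrite -mulr_natr mulVf ?mul1r// pnatr_eq0 -lt0n.
Qed.

End Codes.

(** * A dimension-free code for the distances to finitely many points *)

Section DimensionFreeCode.
Variables (R : realType) (d : nat) (J : finType).

(** [None] is an idle step: it pads every approximation to the same length, so that approximations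
    are tuples over a finite alphabet. *)
Definition greedy_step (u : J -> 'rV[R]_d) (e : nat) (s : option (J * bool)) : 'rV[R]_d :=
  if s is Some (j, b) then ((-1) ^+ b * e%:R^-1) *: u j else 0.

(* Whenever some [|<u j, v>| > 1/e], subtracting [+-u j / e] from [v] decreases
   [|v|^2] by at least [1/e^2], so at most [T] subtractions are possible. *)
Lemma greedy_approx (u : J -> 'rV[R]_d) e T (v : 'rV[R]_d) : (0 < e)%N ->
  (forall j, enorm (u j) <= 1) -> enorm v ^+ 2 <= T%:R / e%:R ^+ 2 ->
  exists t : T.-tuple (option (J * bool)),
    forall j, `|dot (u j) (v - \sum_(s <- t) greedy_step u e s)| <= e%:R^-1.
Proof.
move=> e0 u1; elim: T v => [|T IH] v vT.
  exists [tuple] => j; rewrite big_nil subr0.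
  have -> : v = 0.
    by apply/enorm_eq0/eqP; rewrite -sqrf_eq0 eq_le sqr_ge0 andbT (le_trans vT)// mul0r.
  by rewrite dotC dot0l normr0 invr_ge0 ler0n.
have eR : 0 < e%:R^-1 :> R by rewrite invr_gt0 ltr0n.
have [/forallP H|/forallPn[j]] := boolP [forall j, `|dot (u j) v| <= e%:R^-1].
  have idle k : \sum_(s <- nseq k None) greedy_step u e s = 0.
    by elim: k => [|k IHk]; rewrite ?big_nil// big_cons IHk addr0.
  by exists (nseq_tuple T.+1 None) => j; rewrite (idle T.+1) subr0.
rewrite -ltNge => uv.
pose b := dot (u j) v < 0.
have sb : dot (u j) v * (-1) ^+ b = `|dot (u j) v|.
  by rewrite /b; case: (ger0P (dot (u j) v)) => _; rewrite ?mulr1// mulrN1.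
have [|t tP] := IH (v - greedy_step u e (Some (j, b))).
  rewrite sqr_enormB /= enormZ dotZr normrM normrX normrN1 expr1n mul1r (gtr0_norm eR).
  rewrite (dotC v).
  have -> : (-1) ^+ b * e%:R^-1 * dot (u j) v = e%:R^-1 * `|dot (u j) v| by rewrite -sb; ring.
  rewrite -natr1 mulrDl mul1r -exprVn in vT; rewrite -exprVn exprMn.
  have u2 : enorm (u j) ^+ 2 <= 1 by rewrite expr_le1// enorm_ge0.
  move: vT uv u2 eR; move: (e%:R^-1) (`|_|) (enorm (u j) ^+ 2) => a x y; nra.
exists [tuple of Some (j, b) :: t] => k /=.
by rewrite big_cons opprD addrA.
Qed.

(* Let [q j0] be the point of the family nearest to [x] and [rho] its distance.
   In [|q j - x|^2 = |q j - q j0|^2 - 2 <q j - q j0, x - q j0> + rho^2] both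
   [|q j - q j0|] and [rho] are [O(|q j - x|)], so an additive [1/e]
   approximation of [rho] and of the normalised inner products gives one of
   [|q j - x|] itself, without the loss of a square root. *)
Lemma unit_ball_distance_code (q : J -> 'rV[R]_d) (e : nat) (j0 : J) : (0 < e)%N ->
  (forall j, enorm (q j) <= 1) ->
  coded (fun x : 'rV[R]_d => enorm x <= 1)
    (fun x y => forall j, `|enorm (q j - x) - enorm (q j - y)| <= 5 / e%:R)
    (#|J| * (2 * e).+1 * (2 * #|J|).+1 ^ (4 * e ^ 2))%N.
Proof.
move=> e0 q1.
have eR : 0 < e%:R :> R by rewrite ltr0n.
have eV : 0 < e%:R^-1 :> R by rewrite invr_gt0.
pose near x := [arg min_(j < j0) enorm (q j - x)]%O.
have nearP x j : enorm (q (near x) - x) <= enorm (q j - x).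
  by rewrite /near; case: arg_minP => // i _; apply.
have diam j x : enorm x <= 1 -> enorm (q j - x) <= 2.
  move=> x1; apply: (le_trans (enormD_le _ _)); rewrite enormN.
  by have := q1 j; lra.
pose u i j : 'rV[R]_d := (enorm (q j - q i))^-1 *: (q j - q i).
have u1 i j : enorm (u i j) <= 1.
  rewrite enormZ ger0_norm ?invr_ge0 ?enorm_ge0//.
  by have [->|n0] := eqVneq (enorm (q j - q i)) 0; rewrite ?mulr0 ?mulVf.
(* Two points of the unit ball are at distance at most 2, so the budget [T / e ^ 2] has to be 4. *)
pose T := (4 * e ^ 2)%N.
have ex x : exists t : T.-tuple (option (J * bool)), enorm x <= 1 -> forall j,
    `|dot (u (near x) j) (x - q (near x) - \sum_(s <- t) greedy_step (u (near x)) e s)|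
      <= e%:R^-1.
  have [x1|] := boolP (enorm x <= 1); last by exists (nseq_tuple T None).
  have [|t tP] := @greedy_approx (u (near x)) e T (x - q (near x)) e0 (u1 _).
    rewrite /T natrM natrX mulfK ?expf_neq0 ?gt_eqF// enormBC.
    have := diam (near x) x x1; have := enorm_ge0 (q (near x) - x); nra.
  by exists t.
have [t tP] := choice ex.
pose rho x := Num.truncn (enorm (q (near x) - x) * e%:R).
have rhoP x : (rho x)%:R <= enorm (q (near x) - x) * e%:R < (rho x).+1%:R.
  by apply: truncn_itv; rewrite mulr_ge0 ?enorm_ge0// ltW.
have rho_lt x : enorm x <= 1 -> (rho x < (2 * e).+1)%N.
  move=> x1; rewrite ltnS -(ler_nat R) natrM.
  case/andP: (rhoP x) => /le_trans + _; apply.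
  by rewrite ler_pM2r// diam.
exists (J * 'I_(2 * e).+1 * T.-tuple (option (J * bool)))%type.
exists (fun x => (near x, inord (rho x), t x)); split.
  by rewrite !card_prod card_ord card_tuple card_option card_prod card_bool mulnC (mulnC #|J| 2)%N mulnC.
move=> x y x1 y1 [nxy rxy txy] j.
have {}rxy : rho x = rho y.
  have := congr1 val rxy.
  by rewrite /= !inordK ?rho_lt.
have := tP x x1 j; have := tP y y1 j; rewrite -txy -nxy.
have := rhoP x; have := rhoP y; rewrite -rxy -nxy -natr1.
have := nearP x j; have := nearP y j; rewrite -nxy.
set i := near x; set S := \sum_(s <- t x) _; set k := (rho x)%:R.
move=> nyj nxj /andP[ky1 ky2] /andP[kx1 kx2] Dy Dx.
set w := q j - q i.
have wE : dot w (x - y) = enorm w * dot (u i j) (x - y).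
  rewrite /u dotZl mulrA -/w; have [w0|w0] := eqVneq (enorm w) 0.
    by rewrite (enorm_eq0 w0) dot0l mulr0.
  by rewrite mulfV// mul1r.
have wdot : `|dot w (x - y)| <= enorm w * (2 / e%:R).
  rewrite wE normrM (ger0_norm (enorm_ge0 w)) ler_wpM2l ?enorm_ge0//.
  have -> : x - y = (x - q i - S) - (y - q i - S).
    by rewrite opprB addrA subrK opprB addrA subrK.
  by rewrite dotDr dotNr (le_trans (ler_normB _ _))//; lra.
(* Triangle inequality through [x], as [q i] is no farther from [x] than [q j]. *)
have wx : enorm w <= 2 * enorm (q j - x).
  have := enormB_le (q j) x (q i); rewrite (enormBC x) -/w; lra.
have wy : enorm w <= 2 * enorm (q j - y).
  have := enormB_le (q j) y (q i); rewrite (enormBC y) -/w; lra.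
have sq z : enorm (q j - z) ^+ 2 = enorm w ^+ 2 - 2 * dot w (z - q i) + enorm (q i - z) ^+ 2.
  by rewrite -[q j - z](subrKA (q i)) -/w -[q i - z]opprB sqr_enormB enormN.
have rr : `|enorm (q i - x) - enorm (q i - y)| <= e%:R^-1.
  rewrite -(ler_pM2r eR) mulVf ?gt_eqF// -[e%:R in leLHS]gtr0_norm// -normrM mulrBl.
  by rewrite ler_norml; apply/andP; split; lra.
have dd : dot w (x - q i) - dot w (y - q i) = dot w (x - y).
  by rewrite -dotNr -dotDr opprB addrA subrK.
have := sq x; have := sq y.
move: wdot rr wx wy nxj nyj (enorm_ge0 (q j - x)) (enorm_ge0 (q j - y)) (enorm_ge0 (q i - x))
  (enorm_ge0 (q i - y)) (enorm_ge0 w) dd eV.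
rewrite -(mulrC e%:R^-1 5) -(mulrC e%:R^-1 2).
move: (dot w (x - y)) (dot w (x - q i)) (dot w (y - q i)) (e%:R^-1) => D D1 D2 h.
move: (enorm (q i - x)) (enorm (q i - y)) (enorm (q j - x)) (enorm (q j - y)) (enorm w) => r r' a a' n.
move=> HD Hr wa wa' ra ra' a0 a0' r0 r0' n0 DD h0 E2 E1.
have [aa|aa] := eqVneq (a + a') 0.
  have -> : a - a' = 0 by lra.
  by rewrite normr0 mulr_ge0// ltW.
have ap : 0 < a + a' by rewrite lt_def aa addr_ge0.
rewrite -(ler_pM2r ap) -{1}[a + a']gtr0_norm// -normrM.
(* The difference of squares gains a factor [a + a'] to divide by. As [n <= a + a'] and
   [r + r' <= a + a'], the inner product contributes [4 * h] and the nearest distance [h], hence the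
   constant 5. *)
have -> : (a - a') * (a + a') = - (2 * D) + (r - r') * (r + r').
  by rewrite -DD; move: E1 E2; rewrite !expr2; nra.
apply: (le_trans (ler_normD _ _)); rewrite normrN !normrM ger0_norm//.
rewrite (ger0_norm (addr_ge0 r0 r0')).
apply: (@le_trans _ _ (2 * (n * (h * 2)) + h * (r + r'))).
  by apply: lerD; [rewrite ler_pM2l|rewrite ler_wpM2r// addr_ge0].
nra.
Qed.

End DimensionFreeCode.

(** * Lipschitz bounds for DTW and k-DTW *)

Section Traversals.

(** A step lowers no coordinate and raises their sum; this bounds both the length and the visited
    indices. *)
Lemma trav_path a s : path trav_step a s ->
  (size s + (a.1 + a.2) <= (last a s).1 + (last a s).2)%N /\
  forall x, x \in a :: s -> ((x.1 <= (last a s).1) && (x.2 <= (last a s).2))%N.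
Proof.
elim: s a => [|b s IH] a /=.
  by move=> _; split=> // x; rewrite inE => /eqP->; rewrite !leqnn.
move=> /andP[ab /IH[sz le]].
have [ab1 ab2 ab3] : [/\ a.1 <= b.1, a.2 <= b.2 & a.1 + a.2 < b.1 + b.2]%N.
  by case/or3P: ab => /andP[/eqP-> /eqP->]; split; lia.
split; first by lia.
move=> x; rewrite inE => /predU1P[->|]; last exact: le.
by case/andP: (le b (mem_head _ _)) => b1 b2; rewrite (leq_trans ab1)// (leq_trans ab2).
Qed.

Lemma traversal_size p q s : is_traversal p q s -> (size s <= p.-1 + q.-1)%N.
Proof. by case/andP=> /trav_path[+ _] /eqP E; rewrite E /= !addn0. Qed.

Lemma traversal_bound p q s ij : (0 < p)%N -> (0 < q)%N -> is_traversal p q s ->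
  ij \in (0, 0)%N :: s -> (ij.1 < p)%N && (ij.2 < q)%N.
Proof.
move=> p0 q0 /andP[/trav_path[_ le] /eqP sE] /le; rewrite sE /=.
by move=> /andP[i1 i2]; rewrite -(ltn_predK p0) -(ltn_predK q0) !ltnS i1.
Qed.

End Traversals.

(** * Minima over traversals of an abstract cost *)

Section TraversalMin.
Variables (R : realType) (m : nat) (K : R) (cost : seq R -> R).
Hypotheses (m0 : (0 < m)%N) (K0 : 0 <= K).
Hypothesis cost_ge0 : forall xs : seq R, (forall x : R, x \in xs -> 0 <= x) -> 0 <= cost xs.
Hypothesis cost_ub : forall xs (r : R), (size xs <= 2 * m)%N -> 0 <= r ->
  (forall x, x \in xs -> x <= r) -> cost xs <= K * r.
Hypothesis cost_le : forall (I : eqType) (s : seq I) (f g : I -> R) (e : R), (size s <= 2 * m)%N ->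
  0 <= e -> {in s, forall i, f i <= g i + e} ->
  cost [seq f i | i <- s] <= cost [seq g i | i <- s] + K * e.
Variable d : nat.
Implicit Types s t : m.-tuple 'rV[R]_d.

(** The common shape of [dtw] and [kdtw], with [cost] the plain sum or [topk_sum k]. *)
Definition traversal_min (sigma tau : seq 'rV[R]_d) : R :=
  inf [set cost (matched_dists sigma tau s)
      | s in [set s | is_traversal (size sigma) (size tau) s]]%classic.

Let trav s t a : is_traversal (size s) (size t) a -> (size ((0, 0)%N :: a) <= 2 * m)%N /\
  forall ij, ij \in (0, 0)%N :: a -> exists i j : 'I_m, ij = (nat_of_ord i, nat_of_ord j).
Proof.
rewrite !size_tuple => ta; split; first by have := traversal_size ta; rewrite /=; lia.
move=> ij /(traversal_bound m0 m0 ta)/andP[i1 i2].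
by exists (Ordinal i1), (Ordinal i2); rewrite /= -surjective_pairing.
Qed.

Let A s t := [set cost (matched_dists s t a)
  | a in [set a | is_traversal (size s) (size t) a]]%classic.

Let A_ge0 s t : lbound (A s t) 0.
Proof.
by move=> _ [a _ <-]; apply: cost_ge0 => _ /mapP[ij _ ->]; exact: enorm_ge0.
Qed.

Let A_le s t a : is_traversal (size s) (size t) a ->
  traversal_min s t <= cost (matched_dists s t a).
Proof. by move=> ta; apply: ge_inf; [exists 0; exact: A_ge0|exists a]. Qed.

Lemma traversal_min_ge0 s t : 0 <= traversal_min s t.
Proof.
(* The infimum of an empty set of costs is 0 by convention. *)
have [E|/set0P AN] := eqVneq (A s t) set0; last exact: lb_le_inf AN (@A_ge0 s t).
by rewrite /traversal_min -/(A s t) E inf0.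
Qed.

Lemma traversal_min_le s t (r : R) : 0 <= r ->
  (forall i j, enorm (tnth s i - tnth t j) <= r) -> traversal_min s t <= K * r.
Proof.
move=> r0 str; have [E|/set0P[_ [a ta _]]] := eqVneq (A s t) set0.
  by rewrite /traversal_min -/(A s t) E inf0 mulr_ge0.
apply: (le_trans (A_le ta)); have [sz {}ta] := trav ta.
apply: cost_ub; rewrite ?size_map// => _ /mapP[ij ija ->].
by have [i [j ->]] := ta ij ija; rewrite /= -!tnth_nth.
Qed.

(** Traversals depend only on the sizes, so each traversal for [t'] also serves [t], at a cost
    larger by at most [K * e]; the roles are then exchanged. *)
Lemma traversal_min_lip s t t' (e : R) : 0 <= e ->
  (forall i j, `|enorm (tnth s i - tnth t j) - enorm (tnth s i - tnth t' j)| <= e) ->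
  `|traversal_min s t - traversal_min s t'| <= K * e.
Proof.
move=> e0.
have le (u u' : m.-tuple 'rV[R]_d) : (forall i j, `|enorm (tnth s i - tnth u j) - enorm (tnth s i - tnth u' j)| <= e) ->
    traversal_min s u <= traversal_min s u' + K * e.
  move=> uu; have [E|/set0P AN] := eqVneq (A s u) set0.
    rewrite [leLHS]/traversal_min -/(A s u) E inf0.
    by rewrite addr_ge0 ?traversal_min_ge0 ?mulr_ge0.
  have AN' : (A s u' !=set0)%classic.
    by case: AN => _ [a ta _]; exists (cost (matched_dists s u' a)), a => //; rewrite /= !size_tuple in ta *.
  rewrite -lerBlDr; apply: lb_le_inf => // _ [a ta <-].
  have ta' : is_traversal (size s) (size u) a by rewrite /= !size_tuple in ta *.
  rewrite lerBlDr (le_trans (A_le ta'))//; have [sz {}ta'] := trav ta'.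
  apply: cost_le => // ij ija; have [i [j ->]] := ta' ij ija.
  rewrite /= -!tnth_nth; have := ler_norm (enorm (tnth s i - tnth u j) - enorm (tnth s i - tnth u' j)).
  by have := uu i j; lra.
move=> tt; have := le t t' tt; have := le t' t (fun i j => ltac:(rewrite distrC; exact: tt)).
by rewrite ler_norml; lra.
Qed.

End TraversalMin.

(** * Order statistics and sums of the largest entries *)

Section TopkSum.
Variable R : realType.

(** Comparisons of order statistics become comparisons of counts, which ignore the order of the
    list. *)
Lemma leq_nth_sorted (s : seq R) l (t : R) : sorted (fun x y : R => y <= x) s -> (l < size s)%N ->
  (t <= nth 0 s l) = (l < count (fun x : R => (t <= x)%R) s)%N.
Proof.
elim: s l => [//|x s IH] l /= xs.
have xmax : all (fun y : R => y <= x) s by apply: order_path_min xs => ? ? ? /[swap]; exact: le_trans.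
have c0 : (t <= x) = false -> count (fun y : R => t <= y) s = 0%N.
  move=> tx; apply/eqP; rewrite -leqn0 leqNgt -has_count; apply/hasPn => y ys.
  by apply: contraFN tx => /le_trans; apply; exact: (allP xmax).
case: l => [_|l sl] /=; case tx: (t <= x); rewrite ?(c0 tx)//.
  by rewrite add1n ltnS IH// (path_sorted xs).
by rewrite IH ?(path_sorted xs)// (c0 tx).
Qed.

Lemma sort_ge_sorted (s : seq R) : sorted (fun x y : R => y <= x) (sort (fun x y : R => y <= x) s).
Proof. by apply: sort_sorted => x y; exact: le_total. Qed.

(** If [t] is the entry of rank [l] for [f], more than [l] indices satisfy [f i >= t], and each of
    them satisfies [g i >= t - e]. *)
Lemma nth_sort_le (I : eqType) (s : seq I) (f g : I -> R) (e : R) l :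
  0 <= e -> {in s, forall i, f i <= g i + e} ->
  nth 0 (sort (fun x y : R => y <= x) [seq f i | i <- s]) l <=
  nth 0 (sort (fun x y : R => y <= x) [seq g i | i <- s]) l + e.
Proof.
move=> e0 fg; have [ls|ls] := ltnP l (size s); last first.
  by rewrite !nth_default ?size_sort ?size_map ?add0r.
rewrite -lerBlDr leq_nth_sorted ?sort_ge_sorted ?size_sort ?size_map//.
set t := nth 0 _ l; have : t <= nth 0 (sort (fun x y : R => y <= x) [seq f i | i <- s]) l by [].
rewrite leq_nth_sorted ?sort_ge_sorted ?size_sort ?size_map// => /leq_trans; apply.
rewrite !(permP (permEl (perm_sort _ _))) !count_map.
clearbody t; clear ls; elim: s fg => //= i s' IH fg; apply: leq_add; last first.
  by apply: IH => j js; apply: fg; rewrite inE js orbT.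
have fgi : f i <= g i + e := fg i (mem_head _ _).
by case: (leP t (f i)) => //= tf; rewrite (_ : t - e <= g i)//; lra.
Qed.

Lemma topk_sum_le k (I : eqType) (s : seq I) (f g : I -> R) (e : R) :
  0 <= e -> {in s, forall i, f i <= g i + e} ->
  topk_sum k [seq f i | i <- s] <= topk_sum k [seq g i | i <- s] + k%:R * e.
Proof.
move=> e0 fg; rewrite mulr_natl -[k in _ *+ k]card_ord -sumr_const -big_split.
by apply: ler_sum => l _; exact: nth_sort_le.
Qed.

Lemma nth_sort_mem (xs : seq R) l :
  nth 0 (sort (fun x y : R => y <= x) xs) l = 0 \/ nth 0 (sort (fun x y : R => y <= x) xs) l \in xs.
Proof.
have [ls|ls] := ltnP l (size xs); last by left; rewrite nth_default ?size_sort.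
by right; rewrite -(mem_sort (fun x y : R => y <= x)) mem_nth// size_sort.
Qed.

Lemma topk_sum_ge0 k (xs : seq R) : (forall x, x \in xs -> 0 <= x) -> 0 <= topk_sum k xs.
Proof.
by move=> xs0; apply: sumr_ge0 => l _; case: (nth_sort_mem xs l) => [->//|/xs0].
Qed.

Lemma topk_sum_ub k (xs : seq R) (r : R) : 0 <= r ->
  (forall x, x \in xs -> x <= r) -> topk_sum k xs <= k%:R * r.
Proof.
move=> r0 xsr; rewrite mulr_natl -[k in _ *+ k]card_ord -sumr_const.
by apply: ler_sum => l _; case: (nth_sort_mem xs l) => [->//|/xsr].
Qed.

End TopkSum.

(** Closeness is measured on vertex distances instead of vertices, since the dimension-free code
    controls only distances to sample vertices. *)
Definition lipschitz_distance (R : realType) (m : nat) (K : R)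
    (dist : forall d, seq 'rV[R]_d -> seq 'rV[R]_d -> R) :=
  forall d (s t t' : m.-tuple 'rV[R]_d) e, 0 <= e ->
  [/\ 0 <= dist d s t,
    (forall i j, enorm (tnth s i - tnth t j) <= e) -> dist d s t <= K * e &
    (forall i j, `|enorm (tnth s i - tnth t j) - enorm (tnth s i - tnth t' j)| <= e) ->
    `|dist d s t - dist d s t'| <= K * e].

(** The constant bounds the number of matched pairs of a traversal. *)
Lemma dtw_lipschitz (R : realType) m : (0 < m)%N ->
  lipschitz_distance m (2 * m%:R : R) (@dtw R).
Proof.
move=> m0 d s t t' e e0.
have K0 : 0 <= 2 * m%:R :> R by rewrite mulr_ge0.
have c0 (xs : seq R) : (forall x, x \in xs -> 0 <= x) -> 0 <= \sum_(x <- xs) x.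
  by move=> xs0; rewrite big_seq sumr_ge0.
have sz (I : eqType) (xs : seq I) (r : R) : (size xs <= 2 * m)%N -> 0 <= r ->
    \sum_(x <- xs) r <= 2 * m%:R * r.
  move=> xm r0; rewrite big_const_seq count_predT iter_addr_0 -(mulr_natl r).
  by rewrite ler_wpM2r// -natrM ler_nat.
have cub (xs : seq R) (r : R) : (size xs <= 2 * m)%N -> 0 <= r ->
    (forall x, x \in xs -> x <= r) -> \sum_(x <- xs) x <= 2 * m%:R * r.
  move=> xm r0 xr; apply: le_trans (sz _ _ _ xm r0).
  by rewrite big_seq [leRHS]big_seq; exact: ler_sum.
have cle (I : eqType) (xs : seq I) (f g : I -> R) (r : R) : (size xs <= 2 * m)%N -> 0 <= r ->
    {in xs, forall i, f i <= g i + r} ->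
    \sum_(x <- [seq f i | i <- xs]) x <= \sum_(x <- [seq g i | i <- xs]) x + 2 * m%:R * r.
  move=> xm r0 fg; rewrite !big_map; apply: le_trans (lerD (lexx _) (sz _ _ _ xm r0)).
  by rewrite -big_split big_seq [leRHS]big_seq; exact: ler_sum.
by split; [exact: (@traversal_min_ge0 _ _ _ c0)
  |exact: (@traversal_min_le _ _ _ _ m0 K0 c0 cub)
  |exact: (@traversal_min_lip _ _ _ _ m0 K0 c0 cle)].
Qed.

Lemma kdtw_lipschitz (R : realType) m k : (0 < m)%N ->
  lipschitz_distance m (k%:R : R) (kdtw k).
Proof.
move=> m0 d s t t' e e0; have K0 : 0 <= k%:R :> R by [].
have c0 := @topk_sum_ge0 R k.
have cub (xs : seq R) r (_ : (size xs <= 2 * m)%N) := @topk_sum_ub R k xs r.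
have cle (I : eqType) (xs : seq I) f g r (_ : (size xs <= 2 * m)%N) :=
  @topk_sum_le R k I xs f g r.
by split; [exact: (@traversal_min_ge0 _ _ _ c0)
  |exact: (@traversal_min_le _ _ _ _ m0 K0 c0 cub)
  |exact: (@traversal_min_lip _ _ _ _ m0 K0 c0 cle)].
Qed.

(** * Complexity bounds *)

Section Complexities.
Variable R : realType.
Implicit Type dist : forall d, seq 'rV[R]_d -> seq 'rV[R]_d -> R.

(** From [ln x >= 1 - 1 / x]. It lets logarithms absorb absolute constants. *)
Lemma ln_ge_half (x : R) : 2 <= x -> 1 / 2 <= ln x.
Proof.
move=> x2; have x0 : 0 < x by lra.
have := expR_ge1Dx (- ln x); rewrite expRN lnK ?posrE// => h.
have : x^-1 <= 2^-1 by rewrite lef_pV2 ?posrE.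
lra.
Qed.

Lemma exp2_le_expR k : (2 ^ k)%:R <= expR k%:R :> R.
Proof.
have e2 : 2 <= expR 1 :> R by rewrite (le_trans _ (expR_ge1Dx 1))//; lra.
by rewrite natrX -[k%:R]mulr1 mulrC expRM_natr lerXn2r ?nnegrE ?expR_ge0.
Qed.

(** The zero curve is a candidate. The Gaussian estimate applies to nonnegative integrands. *)
Lemma sup_emp_ge0 dist d m n (P : 'I_n -> m.-tuple 'rV[R]_d) (w : 'I_n -> R) :
  (0 <= sup_emp dist P w)%E.
Proof.
apply: (@le_trans _ _ (`| n%:R^-1 * \sum_(i < n) dist d (P i) (nseq_tuple m 0) * w i |)%:E).
  by rewrite lee_fin.
apply: ereal_sup_ubound; exists (nseq_tuple m 0) => // j.
by rewrite (tnth_nth 0) nth_nseq ltn_ord enorm0.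
Qed.

Lemma complexity_le dist d m n (P : 'I_n -> m.-tuple 'rV[R]_d) G B :
  exp_dominated G B ->
  (forall w (psi : m.-tuple 'rV[R]_d), unit_ball_curves psi ->
    `|n%:R^-1 * \sum_(i < n) dist d (P i) psi * w i| <= G w) ->
  (rademacher dist P <= B%:E)%E /\ (gaussian dist P <= B%:E)%E.
Proof.
move=> GB PG.
have supG w : (sup_emp dist P w <= (G w)%:E)%E.
  by apply: ge_ereal_sup => _ [psi psiB <-]; rewrite lee_fin PG.
split; first exact: (rademacher_average_le GB supG).
by apply: (gaussian_average_le GB) => w; rewrite sup_emp_ge0 supG.
Qed.

Lemma geometric_sum_le (L : nat) : \sum_(l < L) (2 / 4 : R) ^+ l <= 2.
Proof.
suff: \sum_(l < L) (2 / 4 : R) ^+ l = 2 - 2 * (2 / 4) ^+ L.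
  by move=> ->; rewrite lerBlDr lerDl mulr_ge0 ?exprn_ge0.
elim: L => [|L IH]; first by rewrite big_ord0; lra.
by rewrite big_ord_recr/= IH exprS; lra.
Qed.

(** With [e = 4 ^ l], the factors are at most [N] to the powers [e ^ 2], [2 * e ^ 2] and
    [12 * e ^ 2], by [2 * e + 1 <= 4 ^ e] and [2 * N + 1 <= N ^ 3]. *)
Lemma distance_code_card_le N l : (2 <= N)%N ->
  (N * (2 * 4 ^ l).+1 * (2 * N).+1 ^ (4 * (4 ^ l) ^ 2) <= N ^ (15 * 16 ^ l))%N.
Proof.
move=> N2; rewrite (_ : 16 ^ l = (4 ^ l) ^ 2)%N; last by rewrite -expnM mulnC expnM.
set e := (4 ^ l)%N; have e0 : (0 < e)%N by rewrite expn_gt0.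
have e1 : (e <= e ^ 2)%N by rewrite expnS expn1 leq_pmulr.
have N0 : (0 < N)%N by exact: ltnW.
rewrite (_ : 15 * e ^ 2 = e ^ 2 + 2 * e ^ 2 + 3 * (4 * e ^ 2))%N; last by lia.
rewrite (expnD N (e ^ 2 + 2 * e ^ 2)%N) (expnD N (e ^ 2)%N).
apply: leq_mul; first apply: leq_mul.
- by rewrite -{1}(expn1 N) leq_pexp2l// (leq_trans e0).
- apply: (@leq_trans (4 ^ e)).
    by elim: (e) => // k IH; rewrite expnS; lia.
  rewrite (expnM N 2); apply: (@leq_trans ((N ^ 2) ^ e)).
    by rewrite leq_exp2r// -[4%N]/(2 ^ 2)%N leq_exp2r.
  by rewrite leq_pexp2l// expn_gt0 N0.
- rewrite [leqRHS]expnM leq_exp2r; last by rewrite muln_gt0 expn_gt0 e0.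
  by rewrite !expnS expn0; nia.
Qed.

Section Bounds.
Variables (dist : forall d, seq 'rV[R]_d -> seq 'rV[R]_d -> R) (d m n : nat).
Variables (K : R) (P : 'I_n -> m.-tuple 'rV[R]_d).
Hypotheses (m2 : (2 <= m)%N) (n0 : (0 < n)%N) (K0 : 0 < K).
Hypothesis distK : lipschitz_distance m K dist.
Hypothesis P1 : forall i j, enorm (tnth (P i) j) <= 1.

Let f (psi : m.-tuple 'rV[R]_d) i := dist (P i) psi.

Let f_le (psi : m.-tuple 'rV[R]_d) i : unit_ball_curves psi -> `|f psi i| <= 2 * K.
Proof.
move=> psi1; have [f0 + _] := distK (P i) psi psi (ler0n R 2).
rewrite mulrC; move/(_ _); rewrite ger0_norm//; apply => a b.
by rewrite (le_trans (enormD_le _ _))// enormN (le_trans (lerD (P1 i a) (psi1 b))).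
Qed.

(** Grid codes of [m] vertices at scale [4 ^- l] have entropy at most [4 * d * m * 4 ^ l], which is
    chaining with [h = 2 * sqrt (d * m)] and [b = 2]. The series sums to at most 2, and
    [70 = 16 * 2 * 2 + 6]. *)
Lemma complexity_dimension : let B := 4 * (70 + 2 * expR 2) * K * Num.sqrt (m%:R * d%:R / n%:R) in
  (rademacher dist P <= B%:E)%E /\ (gaussian dist P <= B%:E)%E.
Proof.
(* In dimension 0 the parameter [h] would vanish; there all vertex distances, hence [dist], are
   0. *)
have [d0|d0] := posnP d.
  apply: (@complexity_le _ _ _ _ _ (fun=> 0)).
    rewrite d0 mulr0 mul0r sqrtr0 mulr0; exact: exp_dominated0.
  move=> w psi _; rewrite big1 ?mulr0 ?normr0// => i _.
  have [f0 fle _] := distK (P i) psi psi (lexx 0).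
  suff -> : dist (P i) psi = 0 by rewrite mul0r.
  apply/eqP; rewrite eq_le f0 andbT -(mulr0 K) fle// => a b.
  by rewrite enormE /dot big1 ?sqrtr0// => -[k kd]; exfalso; rewrite d0 in kd.
have code l : coded (@unit_ball_curves R d m)
    (fun x y => forall i, `|f x i - f y i| <= 2 * K / 4 ^+ l) ((2 ^ (4 * (d * 4 ^ l))) ^ m)%N.
  have e0 : (0 < 4 ^ l)%N by rewrite expn_gt0.
  have [J [c [JN cE]]] := coded_tuple m (unit_ball_grid_code R d e0).
  exists J, c; split=> // x y x1 y1 /(cE _ _ x1 y1) xy i.
  have h0 : 0 <= (4 ^ l)%:R^-1 :> R by rewrite invr_ge0.
  have [_ _ lip] := distK (P i) x y h0.
  apply: le_trans (lip _) _ => [a b|].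
    by rewrite (le_trans (enormB_norm_le _ _ _))//.
  by rewrite -natrX ler_wpM2r//; move: K0; lra.
pose J l := projT1 (cid (code l)).
pose c l := projT1 (cid (projT2 (cid (code l)))).
have JN l : (#|J l| <= (2 ^ (4 * (d * 4 ^ l))) ^ m)%N by case: (projT2 (cid (projT2 (cid (code l))))).
have cE l (x y : m.-tuple 'rV[R]_d) i : unit_ball_curves x -> unit_ball_curves y -> c l x = c l y ->
    `|f x i - f y i| <= 2 * K / 4 ^+ l.
  by case: (projT2 (cid (projT2 (cid (code l))))) => _ H x1 y1 /H; apply.
have dm1 : 1 <= Num.sqrt (d%:R * m%:R) :> R.
  by rewrite -natrM -[leLHS]sqrtr1 ler_sqrt// ler1n muln_gt0 d0; move: m2; lia.
have [|||||G GB GP] := @chaining R n _ (@unit_ball_curves R d m) f J c (2 * K)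
  (2 * Num.sqrt (d%:R * m%:R)) 2 n0 _ _ _ _ cE _ n (ltnW (ltn_expl n (isT : 1 < 4)%N)).
- by rewrite mulr_gt0.
- by lra.
- by lra.
- by move=> x i /f_le.
- move=> l; apply: (@le_trans _ _ ((2 ^ (4 * (d * 4 ^ l))) ^ m)%:R); first by rewrite ler_nat.
  rewrite -expnM (le_trans (exp2_le_expR _))// ler_expR !exprMn sqr_sqrtr ?mulr_ge0//.
  rewrite !natrM natrX -exprM mulnC exprM (_ : 2 ^+ 2 = 4 :> R); last by ring.
  by rewrite le_eqVlt; apply/orP; left; apply/eqP; ring.
apply: (complexity_le _ GP); apply: exp_dominatedW GB => //.
rewrite (mulrC m%:R) [Num.sqrt (_ / _)]sqrtrM ?mulr_ge0// sqrtrV ?ler0n//.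
set s := Num.sqrt _; set t := (Num.sqrt _)^-1.
rewrite (_ : 4 * _ * K * (s * t) = 2 * K * (2 * s) * t * (70 + 2 * expR 2)); last by ring.
rewrite ler_wpM2l//; first by rewrite !mulr_ge0 ?invr_ge0 ?sqrtr_ge0// ltW.
rewrite lerD2r; have := geometric_sum_le n; lra.
Qed.

(** The entropy [15 * 16 ^ l * m * y] corresponds to [h = 4 * sqrt (m * y)] and [b = 4]. All levels
    cost the same, so their number [L <= 4 * y] becomes a factor and turns [m * y] into [m * y ^+ 3]
    under the root. Since [1 <= 2 * y], [64 * L + 6 + 2 * expR 2 <= (268 + 4 * expR 2) * y]. *)
Lemma complexity_dimension_free :
  let B := 20 * (268 + 4 * expR 2) * K * Num.sqrt (m%:R * ln (m * n)%:R ^+ 3 / n%:R) in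
  (rademacher dist P <= B%:E)%E /\ (gaussian dist P <= B%:E)%E.
Proof.
pose N := (m * n)%N; pose y : R := ln N%:R.
have N2 : (2 <= N)%N by rewrite (leq_trans m2)// leq_pmulr.
have y2 : 1 / 2 <= y by apply: ln_ge_half; rewrite ler_nat.
have j0 : 'I_n * 'I_m by split; [exact: Ordinal n0|exact: Ordinal (ltnW m2)].
have code l : coded (@unit_ball_curves R d m)
    (fun x y => forall i, `|f x i - f y i| <= 5 * K / 4 ^+ l)
    (N ^ (15 * 16 ^ l * m))%N.
  have e0 : (0 < 4 ^ l)%N by rewrite expn_gt0.
  have [J [c [JN cE]]] := coded_tuple m
    (unit_ball_distance_code j0 e0 (fun p => P1 p.1 p.2)).
  exists J, c; split.
    apply: (leq_trans JN); rewrite card_prod !card_ord (mulnC n) -/N.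
    by rewrite [leqRHS]expnM leq_exp2r ?distance_code_card_le// ltnW.
  move=> x z x1 z1 /(cE _ _ x1 z1) xz i.
  have h0 : 0 <= 5 / (4 ^ l)%:R :> R by rewrite divr_ge0.
  have [_ _ lip] := distK (P i) x z h0.
  apply: le_trans (lip _) _ => [a b|]; first exact: (xz b (i, a)).
  by rewrite natrX mulrA (mulrC K).
pose J l := projT1 (cid (code l)).
pose c l := projT1 (cid (projT2 (cid (code l)))).
have JN l : (#|J l| <= N ^ (15 * 16 ^ l * m))%N by case: (projT2 (cid (projT2 (cid (code l))))).
have cE l (x z : m.-tuple 'rV[R]_d) i : unit_ball_curves x -> unit_ball_curves z -> c l x = c l z ->
    `|f x i - f z i| <= 5 * K / 4 ^+ l.
  by case: (projT2 (cid (projT2 (cid (code l))))) => _ H x1 z1 /H; apply.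
have my1 : 1 <= Num.sqrt (m%:R * y).
  rewrite -[leLHS]sqrtr1 ler_sqrt; last by rewrite mulr_ge0//; lra.
  have : 2 <= m%:R :> R by rewrite ler_nat.
  by move: y2; nra.
pose L := (trunc_log 2 n).+1.
have nL : (n <= 4 ^ L)%N.
  apply: (leq_trans (ltnW (trunc_log_ltn n (isT : 1 < 2)%N))).
  by rewrite leq_exp2r.
have L4 : L%:R <= 4 * y.
  have h2 : 1 / 2 <= ln (2 : R) by exact: ln_ge_half.
  have : ln ((2 ^ trunc_log 2 n)%:R : R) <= y.
    rewrite ler_ln ?posrE ?ltr0n ?expn_gt0//; last by rewrite (leq_trans _ N2).
    rewrite ler_nat (leq_trans (trunc_logP _ n0))// leq_pmull//; exact: ltnW m2.
  rewrite natrX lnXn// -(mulr_natl (ln 2)) /L -[(trunc_log 2 n).+1%:R]natr1.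
  have : 0 <= (trunc_log 2 n)%:R :> R by [].
  move: (trunc_log 2 n)%:R => x; nra.
have [|||||G GB GP] := @chaining R n _ (@unit_ball_curves R d m) f J c (5 * K)
  (4 * Num.sqrt (m%:R * y)) 4 n0 _ _ _ _ cE _ L nL.
- by rewrite mulr_gt0.
- by lra.
- by lra.
- by move=> x i /f_le /le_trans; apply; rewrite ler_wpM2r// ?ltW//; lra.
- move=> l; apply: (@le_trans _ _ (N ^ (15 * 16 ^ l * m))%:R); first by rewrite ler_nat.
  rewrite natrX -[N%:R]lnK ?posrE ?ltr0n; last by rewrite (leq_trans _ N2).
  rewrite -expRM_natr ler_expR !exprMn sqr_sqrtr; last by rewrite mulr_ge0//; lra.
  rewrite -/y (_ : (4 ^+ l) ^+ 2 = 16 ^+ l); last by rewrite -exprM mulnC exprM; congr (_ ^+ _); ring.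
  rewrite !natrM natrX.
  have : 0 <= 16 ^+ l * (m%:R * y) by rewrite !mulr_ge0 ?exprn_ge0//; lra.
  by move: (16 ^+ l) (m%:R) => z a; lra.
apply: (complexity_le _ GP); apply: exp_dominatedW GB => //.
have -> : \sum_(l < L) (4 / 4 : R) ^+ l = L%:R.
  by rewrite divff// (eq_bigr (fun=> 1)) ?sumr_const ?card_ord// => l _; rewrite expr1n.
have -> : m%:R * ln (m * n)%:R ^+ 3 / n%:R = (y ^+ 2) * ((m%:R * y) / n%:R) :> R.
  by rewrite -/N -/y; ring.
rewrite [Num.sqrt (y ^+ 2 * _)]sqrtrM ?sqr_ge0// sqrtr_sqr ger0_norm; last by lra.
rewrite [Num.sqrt (_ / _)]sqrtrM; last by rewrite mulr_ge0//; lra.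
rewrite sqrtrV ?ler0n//.
set s := Num.sqrt _; set t := (Num.sqrt _)^-1.
rewrite (_ : 20 * _ * K * _ = 5 * K * (4 * s) * t * ((268 + 4 * expR 2) * y)); last by ring.
rewrite ler_wpM2l//; first by rewrite !mulr_ge0 ?invr_ge0 ?sqrtr_ge0// ltW.
have := expR_ge0 (2 : R); move: L4 y2; nra.
Qed.

End Bounds.
End Complexities.

(** * The minimum of both bounds *)

Lemma ler_const_sqrt (R : realType) (c c' K X Y : R) : 0 <= c <= c' -> 0 <= K ->
  K ^+ 2 * X <= 16 * Y -> c * K * Num.sqrt X <= 4 * c' * Num.sqrt Y.
Proof.
move=> /andP[c0 cc'] K0 XY.
have sqrtZ (x z : R) : 0 <= x -> x * Num.sqrt z = Num.sqrt (x ^+ 2 * z).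
  by move=> x0; rewrite sqrtrM ?sqr_ge0// sqrtr_sqr ger0_norm.
rewrite (mulrC 4) -!mulrA (sqrtZ K)// (sqrtZ 4)//; apply: ler_pM; rewrite ?sqrtr_ge0// ler_wsqrtr//.
by rewrite (_ : 4 ^+ 2 = 16)//; ring.
Qed.

(** Here [a] is [m] for DTW and [k] for k-DTW. Replacing [K ^+ 2] by [4 * a ^+ 2] and inserting
    [ln a] or [a ^+ 2 * ln (m * n)] costs at most the factor 16 under the root, as the logarithms
    are at least [1 / 2]. *)
Lemma complexity_min (R : realType) (d m n a : nat) (K : R)
    (dist : forall d, seq 'rV[R]_d -> seq 'rV[R]_d -> R) (P : 'I_n -> m.-tuple 'rV[R]_d) :
  (2 <= m)%N -> (0 < n)%N -> (2 <= a)%N -> 0 < K <= 2 * a%:R -> lipschitz_distance m K dist ->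
  (forall i j, enorm (tnth (P i) j) <= 1) ->
  let B := 4 * (20 * (268 + 4 * expR 2)) * Num.sqrt (m%:R * a%:R ^+ 2 *
    Num.min (d%:R * ln a%:R) (a%:R ^+ 2 * ln (m * n)%:R ^+ 4) / n%:R) in
  (rademacher dist P <= B%:E)%E /\ (gaussian dist P <= B%:E)%E.
Proof.
move=> m2 n0 a2 /andP[K0 Ka] distK P1 B.
have aR : 2 <= a%:R :> R by rewrite ler_nat.
have e2 := expR_ge0 (2 : R).
have la : 1 / 2 <= ln a%:R :> R by exact: ln_ge_half.
have lmn : 1 / 2 <= ln (m * n)%:R :> R.
  by apply: ln_ge_half; rewrite ler_nat (leq_trans m2)// leq_pmulr.
have K2 : K ^+ 2 <= 4 * a%:R ^+ 2 by nra.
have a20 : 0 <= a%:R ^+ 2 :> R by exact: sqr_ge0.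
have mn : 0 <= m%:R / n%:R :> R by rewrite divr_ge0.
have weaken x z : x <= z -> (rademacher dist P <= x%:E)%E /\ (gaussian dist P <= x%:E)%E ->
    (rademacher dist P <= z%:E)%E /\ (gaussian dist P <= z%:E)%E.
  by move=> xz [h1 h2]; split; [apply: le_trans h1 _|apply: le_trans h2 _]; rewrite lee_fin.
rewrite /B /Num.min; case: ifP => _.
  apply: weaken (complexity_dimension m2 n0 K0 distK P1).
  apply: ler_const_sqrt; [lra|exact: ltW|].
  rewrite (_ : m%:R * d%:R / n%:R = m%:R / n%:R * d%:R); last by ring.
  rewrite (_ : 16 * _ = a%:R ^+ 2 * (16 * ln a%:R) * (m%:R / n%:R * d%:R)); last by ring.
  by rewrite ler_wpM2r ?mulr_ge0//; nra.
apply: weaken (complexity_dimension_free m2 n0 K0 distK P1).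
apply: ler_const_sqrt; [lra|exact: ltW|].
move: (ln _) lmn => y y2.
have y3 : 0 <= y ^+ 3 by rewrite exprn_ge0//; lra.
rewrite (_ : m%:R * y ^+ 3 / n%:R = m%:R / n%:R * y ^+ 3); last by ring.
rewrite (_ : 16 * _ = a%:R ^+ 2 * (16 * a%:R ^+ 2 * y) * (m%:R / n%:R * y ^+ 3)); last by ring.
apply: ler_wpM2r; first by rewrite mulr_ge0.
apply: (le_trans K2); rewrite mulrC; apply: ler_wpM2l => //.
have : 4 <= a%:R ^+ 2 :> R by nra.
by nra.
Qed.

(** The bound is uniform over all samples in the unit ball, so it covers samples from any
    distribution. The conditions [2 <= m] and [2 <= k] keep [ln m] and [ln k] positive. *)
Theorem theorem4p1 (R : realType) :
  exists C : R, 0 < C /\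
  forall (d m n k : nat) (P : 'I_n -> m.-tuple 'rV[R]_d),
    (2 <= m)%N -> (0 < n)%N ->
    (forall (i : 'I_n) (j : 'I_m), enorm (tnth (P i) j) <= 1) ->
    let bDTW := C * Num.sqrt (m%:R ^+ 3 *
                  Num.min (d%:R * ln m%:R) (m%:R ^+ 2 * ln (m * n)%:R ^+ 4) / n%:R) in
    let bkDTW := C * Num.sqrt (m%:R * k%:R ^+ 2 *
                  Num.min (d%:R * ln k%:R) (k%:R ^+ 2 * ln (m * n)%:R ^+ 4) / n%:R) in
    (rademacher (@dtw R) P <= bDTW%:E)%E /\
    (gaussian (@dtw R) P <= bDTW%:E)%E /\
    ((2 <= k)%N ->
      (rademacher (kdtw k) P <= bkDTW%:E)%E /\
      (gaussian (kdtw k) P <= bkDTW%:E)%E).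
Proof.
have e2 := expR_ge0 (2 : R).
exists (4 * (20 * (268 + 4 * expR 2))); split; first by rewrite !mulr_gt0//; lra.
move=> d m n k P m2 n0 P1 bDTW bkDTW.
have m0 : (0 < m)%N by exact: ltnW.
have [|h1 h2] := @complexity_min R d m n m _ _ P m2 n0 m2 _ (@dtw_lipschitz R m m0) P1.
  by rewrite lexx mulr_gt0 ?ltr0n.
split; first by rewrite /bDTW exprS.
split; first by rewrite /bDTW exprS.
move=> k2; apply: (@complexity_min R d m n k _ _ P m2 n0 k2 _ (@kdtw_lipschitz R m k m0) P1).
have : 2 <= k%:R :> R by rewrite ler_nat.
lra.
Qed.
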